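(* Let $\varphi\in L^\infty$ be such that $K_1(\varphi)\neq\{0\}$, and let $\psi$ be a nonconstant inner function for which the subspace $E_{\varphi,\psi}:=K_1(\varphi)\cap\psi H^1$ is proximinal in $K_1(\varphi)$. Let $f\in K_1(\varphi)$ be such that the coset $f+E_{\varphi,\psi}$ has norm $1$ in $K_1(\varphi)/E_{\varphi,\psi}$. Then the following are equivalent: (i) $f+E_{\varphi,\psi}$ is an extreme point of $\mathrm{ball}\,(K_1(\varphi)/E_{\varphi,\psi})$; (ii) there is a function $h\in K_1(\varphi)$ with $\mathcal{M}(f;K_1(\varphi),E_{\varphi,\psi})=\{h\}$ and such that the inner factors of $h$ and $\overline{z\varphi h}$ are relatively prime.
   Context: $\mathbb{T}$ is the unit circle with normalized Haar measure $m$, $L^p=L^p(\mathbb{T},m)$, and $H^p=\{f\in L^p:\widehat f(k)=0\ \forall k<0\}$ (Hardy space), where $\widehat f(k)=\int_{\mathbb{T}}\bar\zeta^kf(\zeta)\,dm(\zeta)$; $z$ denotes the identity function $z(\zeta)=\zeta$ on $\mathbb{T}$. An inner function is $\psi\in H^\infty$ with $|\psi|=1$ a.e. on $\mathbb{T}$; every nonzero $H^1$ function factors as (inner)$\times$(outer), and its inner factor is the inner function in this factorization. For $\varphi\in L^\infty$, $K_1(\varphi):=\{f\in H^1:\ \overline{z\varphi f}\in H^1\}$ (the kernel in $H^1$ of the Toeplitz operator with symbol $\varphi$), a closed subspace of $H^1$ equipped with the norm $\|\cdot\|_1$. Two functions $u,v\in H^1$ have relatively prime inner factors if there is no nonconstant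 inner function $J$ with $u/J\in H^1$ and $v/J\in H^1$. For a Banach space $X$ and closed subspace $Y$: $X/Y$ carries the quotient norm $\|x+Y\|=\inf_{y\in Y}\|x+y\|$; $\mathcal{M}(x;X,Y):=\{\xi\in x+Y:\|\xi\|=\|x+Y\|_{X/Y}\}$; $Y$ is proximinal in $X$ if $\mathcal{M}(x;X,Y)\neq\emptyset$ for every $x\in X$. $\mathrm{ball}\,(Z)$ denotes the closed unit ball of a Banach space $Z$, and a point of it is extreme if it is not the midpoint of two distinct points of the ball. *)

(* Defs.v *)
From HB Require Import structures.
From mathcomp Require Import all_boot all_order all_algebra.
From mathcomp Require Import all_classical all_reals all_analysis.
From mathcomp Require Import complex.
Set Implicit Arguments. Unset Strict Implicit. Unset Printing Implicit Defensive.
Import Order.TTheory GRing.Theory Num.Theory.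
Local Open Scope classical_set_scope.
Local Open Scope ring_scope.

(* The unit circle T is parametrized by t in [0,1] via t |-> exp(2 pi i t);
   normalized Haar measure m on T corresponds to Lebesgue measure on [0,1].
   A function on T is represented as f : R -> R[i], read on [0,1]. *)
Section Circle.
Variable R : realType.
Local Notation C := R[i].
Local Notation mu := (@lebesgue_measure R).
Definition I01 : set R := `[0%R, 1%R].

Definition cmod (z : C) : R := Num.sqrt (complex.Re z ^+ 2 + complex.Im z ^+ 2).

Definition zpow (k : int) (t : R) : C :=
  Complex (cos (2 * pi * k%:~R * t)) (sin (2 * pi * k%:~R * t)).
Definition zid : R -> C := zpow 1.

Definition ae01 (P : R -> Prop) : Prop := {ae mu, forall t, I01 t -> P t}.

Definition cmeasurable (f : R -> C) : Prop :=
  measurable_fun I01 (fun t => complex.Re (f t)) /\ measurable_fun I01 (fun t => complex.Im (f t)).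

Definition L1 (f : R -> C) : Prop :=
  cmeasurable f /\ (\int[mu]_(t in I01) (cmod (f t))%:E < +oo)%E.

Definition Linf (f : R -> C) : Prop :=
  cmeasurable f /\ exists M : R, ae01 (fun t => cmod (f t) <= M).

Definition norm1 (f : R -> C) : R := \int[mu]_(t in I01) cmod (f t).

Definition fourier (f : R -> C) (k : int) : C :=
  Complex (\int[mu]_(t in I01) complex.Re (conjc (zpow k t) * f t))
          (\int[mu]_(t in I01) complex.Im (conjc (zpow k t) * f t)).

Definition H1 (f : R -> C) : Prop :=
  L1 f /\ forall k : int, k < 0 -> fourier f k = 0.

Definition Hinf (f : R -> C) : Prop :=
  Linf f /\ forall k : int, k < 0 -> fourier f k = 0.

Definition inner (psi : R -> C) : Prop :=
  Hinf psi /\ ae01 (fun t => cmod (psi t) = 1).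

Definition nonconstant (f : R -> C) : Prop :=
  ~ exists c : C, ae01 (fun t => f t = c).

Definition K1 (phi : R -> C) (f : R -> C) : Prop :=
  H1 f /\ H1 (fun t => conjc (zid t * phi t * f t)).

Definition mulH1 (psi : R -> C) (f : R -> C) : Prop :=
  exists g, H1 g /\ ae01 (fun t => f t = psi t * g t).

Definition Espace (phi psi : R -> C) (f : R -> C) : Prop :=
  K1 phi f /\ mulH1 psi f.

Definition qnorm (Y : (R -> C) -> Prop) (x : R -> C) : R :=
  inf [set r | exists y, Y y /\ r = norm1 (fun t => x t + y t)].

Definition Mset (Y : (R -> C) -> Prop) (x : R -> C) (xi : R -> C) : Prop :=
  Y (fun t => xi t - x t) /\ norm1 xi = qnorm Y x.

Definition proximinal (X Y : (R -> C) -> Prop) : Prop :=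
  forall x, X x -> exists xi, Mset Y x xi.

Definition extreme_coset (X Y : (R -> C) -> Prop) (x : R -> C) : Prop :=
  qnorm Y x <= 1 /\
  forall g1 g2, X g1 -> X g2 -> qnorm Y g1 <= 1 -> qnorm Y g2 <= 1 ->
    Y (fun t => x t - (g1 t + g2 t) / 2) -> Y (fun t => g1 t - g2 t).

Definition rel_prime_inner (u v : R -> C) : Prop :=
  ~ exists J, inner J /\ nonconstant J /\
      H1 (fun t => u t / J t) /\ H1 (fun t => v t / J t).

End Circle.

(* Main.v *)
(* Let [h] be a minimizer in the coset of [f] and [v = conj (z phi h)].  If [h] is the
   midpoint of [g1] and [g2], none of norm larger than that of [h], equality in the triangle
   inequality gives [(g1 - g2) / 2 = r h] with [r] real and [|r| <= 1].  Then [r h] and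
   [r v] lie in [H1], so the least inner denominator of [r], which is nonconstant unless [r]
   is constant, divides both [h] and [v]: coprimality forces [g1 = g2].  Conversely, a
   common inner divisor [J] of [h] and [v] yields the perturbations [h + s h] and [h - s h]
   with [s = Re (b J)], both of the norm of [h] for a suitable unimodular [b].
   Extremality puts [s h] in [psi H1], and then [h] itself because [2 b J s = 1 + b^2 J^2]
   is outer; but a minimizer in [psi H1] would make the coset zero.

   Inner-outer factorization is replaced by one principle: if [M] is a closed shift-invariant
   subspace of a weighted [L2] and [q] lies in [M], the projection [J] of [q] onto the
   complement of [z M] has [|J|^2 W] constant, by uniqueness of Fourier coefficients.
   Inside [H2] this is Beurling's theorem; for a space of multipliers of [H1] it is Szego's
   extremal problem, whose solutions are bounded and map [H1] functions to [H2]. *)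
Require Import Defs.
From HB Require Import structures.
From mathcomp Require Import all_boot all_order all_algebra.
From mathcomp Require Import all_classical all_reals all_analysis.
From mathcomp Require Import complex.
From mathcomp Require Import measurable_realfun ring lra.
Set Implicit Arguments.
Unset Strict Implicit.
Unset Printing Implicit Defensive.
Import Order.TTheory GRing.Theory Num.Theory.
Import numFieldNormedType.Exports.
Local Open Scope classical_set_scope.
Local Open Scope complex_scope.
Local Open Scope ring_scope.

Lemma eq_fun_pred (T U : Type) (P : (T -> U) -> Prop) (f g : T -> U) :
  f =1 g -> P f -> P g.
Proof. by move=> /funext ->. Qed.

Section ComplexModulus.
Variable R : realType.
Implicit Types (x : R) (z w : R[i]).

Lemma cmodE z : cmod z = Normc.normc z.
Proof. by case: z. Qed.

Lemma normr_cmod z : `|z| = (cmod z)%:C.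
Proof. by rewrite normc_def. Qed.

Lemma sqr_cmod z : cmod z ^+ 2 = complex.Re z ^+ 2 + complex.Im z ^+ 2.
Proof. by rewrite sqr_sqrtr // addr_ge0 // sqr_ge0. Qed.

Lemma cmod_ge0 z : 0 <= cmod z. Proof. exact: sqrtr_ge0. Qed.

Lemma cmod0 : cmod (0 : R[i]) = 0. Proof. by rewrite cmodE Normc.normc0. Qed.

Lemma cmod1 : cmod (1 : R[i]) = 1. Proof. by rewrite cmodE Normc.normc1. Qed.

Lemma cmod0_eq0 z : cmod z = 0 -> z = 0.
Proof. by rewrite cmodE; exact: Normc.eq0_normc. Qed.

Lemma cmodM z w : cmod (z * w) = cmod z * cmod w.
Proof. by rewrite !cmodE Normc.normcM. Qed.

Lemma cmodX z n : cmod (z ^+ n) = cmod z ^+ n.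
Proof. by elim: n => [|n ih]; rewrite ?cmod1// !exprS cmodM ih. Qed.

Lemma cmodV z : cmod z^-1 = (cmod z)^-1.
Proof. by rewrite !cmodE Normc.normcV. Qed.

Lemma cmodN z : cmod (- z) = cmod z.
Proof. by rewrite !cmodE normcN. Qed.

Lemma cmodBC z w : cmod (z - w) = cmod (w - z).
Proof. by rewrite -cmodN opprB. Qed.

Lemma ler_cmodD z w : cmod (z + w) <= cmod z + cmod w.
Proof. by rewrite !cmodE; exact: le_normcD. Qed.

Lemma ler_cmodB z w : cmod (z - w) <= cmod z + cmod w.
Proof. by rewrite -[cmod w]cmodN ler_cmodD. Qed.

Lemma ler_dist_cmod z w : `|cmod z - cmod w| <= cmod (z - w).
Proof.
have h := ler_cmodD (z - w) w; have h' := ler_cmodD (w - z) z.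
rewrite subrK in h; rewrite subrK cmodBC in h'.
by rewrite ler_norml; apply/andP; split; lra.
Qed.

Lemma cmod_conjc z : cmod (conjc z) = cmod z.
Proof. by case: z => a b; rewrite /cmod /= sqrrN. Qed.

Lemma cmod_real x : cmod x%:C = `|x|.
Proof. by rewrite /cmod /= expr0n /= addr0 sqrtr_sqr. Qed.

Lemma realC2V : (2^-1)%:C = 2^-1 :> R[i].
Proof. by rewrite fmorphV rmorph_nat. Qed.

Lemma cmod_half z : cmod (z / 2) = cmod z / 2.
Proof. by rewrite cmodM -realC2V cmod_real ger0_norm ?invr_ge0. Qed.

Lemma mulc_conjc z : z * conjc z = (cmod z ^+ 2)%:C.
Proof. by rewrite -sqr_normc normr_cmod rmorphXn. Qed.

Lemma conjcM z w : conjc (z * w) = conjc z * conjc w.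
Proof. exact: rmorphM. Qed.

Lemma invc_cmod z : z^-1 = ((cmod z ^+ 2)^-1)%:C * conjc z.
Proof. by rewrite invc_norm normr_cmod fmorphV rmorphXn. Qed.

Lemma conjc_mul_unimodular z : cmod z = 1 -> conjc z * z = 1.
Proof. by move=> z1; rewrite mulrC mulc_conjc z1 expr1n. Qed.

Lemma invc_unimodular z : cmod z = 1 -> z^-1 = conjc z.
Proof. by move=> z1; rewrite invc_cmod z1 expr1n invr1 mul1r. Qed.

Lemma unimodular_neq0 z : cmod z = 1 -> z != 0.
Proof. by apply: contra_eq_neq => ->; rewrite cmod0 eq_sym oner_neq0. Qed.

Lemma Re_mulc z w : complex.Re (z * w) =
  complex.Re z * complex.Re w - complex.Im z * complex.Im w.
Proof. by case: z w => [a b] [c d]. Qed.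

Lemma Im_mulc z w : complex.Im (z * w) =
  complex.Re z * complex.Im w + complex.Im z * complex.Re w.
Proof. by case: z w => [a b] [c d]. Qed.

Lemma Re_conjc z : complex.Re (conjc z) = complex.Re z.
Proof. by case: z => [a b]. Qed.

Lemma Im_conjc z : complex.Im (conjc z) = - complex.Im z.
Proof. by case: z => [a b]. Qed.

Lemma Re_mulcr z x : complex.Re (z * x%:C) = complex.Re z * x.
Proof. by rewrite Re_mulc /= mulr0 subr0. Qed.

Lemma eq_ReIm z w :
  complex.Re z = complex.Re w -> complex.Im z = complex.Im w -> z = w.
Proof. by case: z w => [a b] [c d] /= -> ->. Qed.

Lemma normr_Re_le z : `|complex.Re z| <= cmod z.
Proof. by rewrite -sqrtr_sqr ler_sqrt ?addr_ge0 ?sqr_ge0// lerDl sqr_ge0. Qed.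

Lemma normr_Im_le z : `|complex.Im z| <= cmod z.
Proof. by rewrite -sqrtr_sqr ler_sqrt ?addr_ge0 ?sqr_ge0// lerDr sqr_ge0. Qed.

Lemma cmod_le_ReIm z : cmod z <= `|complex.Re z| + `|complex.Im z|.
Proof.
rewrite -(ler_pXn2r (_ : 0 < 2)%N) ?nnegrE ?cmod_ge0 ?addr_ge0//.
rewrite sqr_cmod sqrrD !real_normK ?num_real// -addrA [X in _ <= _ + X]addrC.
by rewrite addrA lerDl mulrn_wge0// mulr_ge0.
Qed.

Lemma cmod_parallelogram z w :
  cmod (z + w) ^+ 2 + cmod (z - w) ^+ 2 = 2 * cmod z ^+ 2 + 2 * cmod w ^+ 2.
Proof. by rewrite !sqr_cmod !raddfD !raddfN /=; ring. Qed.

Lemma sqr_cmodD_le z w : cmod (z + w) ^+ 2 <= 2 * cmod z ^+ 2 + 2 * cmod w ^+ 2.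
Proof. by rewrite -cmod_parallelogram lerDl sqr_ge0. Qed.

Lemma sqr_cmodDM z w (c : R[i]) : cmod (z + c * w) ^+ 2 =
  cmod z ^+ 2 + 2 * complex.Re (conjc c * (conjc w * z)) + cmod c ^+ 2 * cmod w ^+ 2.
Proof.
rewrite -exprMn -cmodM !sqr_cmod !raddfD /= !(Re_mulc, Im_mulc, Re_conjc, Im_conjc).
by ring.
Qed.

Lemma rotate_to_imaginary (a : R[i]) :
  exists2 b, cmod b = 1 & complex.Re (b * a) = 0.
Proof.
have [->|a0] := eqVneq a 0; first by exists 1; rewrite ?cmod1 ?mulr0.
have na : cmod a != 0 by apply: contraNneq a0 => /cmod0_eq0 ->.
exists (Complex 0 1 * (conjc a * ((cmod a)^-1)%:C)).
  rewrite !cmodM cmod_conjc cmod_real normfV ger0_norm ?cmod_ge0// mulfV// mulr1.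
  by rewrite /cmod /= expr0n add0r expr1n sqrtr1.
have -> : Complex 0 1 * (conjc a * ((cmod a)^-1)%:C) * a =
    Complex 0 1 * ((a * conjc a) * ((cmod a)^-1)%:C) by ring.
by rewrite mulc_conjc -rmorphM /= mul0r mul1r subr0.
Qed.

Lemma cmodD_eq (z w : R[i]) : cmod (z + w) = cmod z + cmod w ->
  z - w = ((cmod z - cmod w) / (cmod z + cmod w))%:C * (z + w).
Proof.
move=> zw; have [|t _ [zE wE]] := @normCDeq _ z w.
  by rewrite !normr_cmod zw rmorphD.
move: zE wE; rewrite !normr_cmod.
have [s0|s0] := eqVneq (cmod z + cmod w) 0.
  have := cmod_ge0 z; have := cmod_ge0 w => w0 z0.
  have -> : z = 0 by apply: cmod0_eq0; lra.
  have -> : w = 0 by apply: cmod0_eq0; lra.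
  by rewrite addr0 subr0 mulr0.
set a := cmod z in s0 *; set b := cmod w in s0 * => -> ->.
rewrite -mulrDl -mulrBl mulrA -rmorphD -rmorphB -rmorphM /=.
by rewrite divfK.
Qed.

Lemma half_1D_unimodular z : cmod z = 1 -> cmod ((1 + z) / 2) < 1 \/ z = 1.
Proof.
move=> z1; have [->|zn] := eqVneq z 1; [by right|left].
have d0 : 0 < cmod (1 - z) ^+ 2.
  by rewrite exprn_even_gt0//=; apply: contraNneq zn => /cmod0_eq0/subr0_eq ->.
have := cmod_parallelogram 1 z; rewrite cmod1 z1 expr1n => h.
by rewrite cmod_half; have := cmod_ge0 (1 + z); nra.
Qed.

Lemma cvg_cmod (u : nat -> R[i]) z : cmod (u n - z) @[n --> \oo] --> (0 : R) ->
  cmod (u n) @[n --> \oo] --> cmod z.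
Proof.
move=> uz; apply/cvgrPdist_le => e e0; near=> n.
rewrite distrC; apply: (le_trans (ler_dist_cmod _ _)).
rewrite -[leLHS]ger0_norm ?cmod_ge0//.
by near: n; exact: (cvgr0Pnorm_le _).1.
Unshelve. all: by end_near. Qed.

Lemma cvg_ReIm (u : nat -> R[i]) z :
  complex.Re (u n) @[n --> \oo] --> complex.Re z ->
  complex.Im (u n) @[n --> \oo] --> complex.Im z ->
  cmod (u n - z) @[n --> \oo] --> (0 : R).
Proof.
move=> ru iu; have h : `|complex.Re (u n - z)| + `|complex.Im (u n - z)|
    @[n --> \oo] --> (0 : R).
  rewrite -[X in _ --> X]addr0.
  apply: cvgD; apply/norm_cvg0P; under eq_fun do rewrite raddfB.
    by rewrite -(subrr (complex.Re z)); apply: cvgB => //; exact: cvg_cst.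
  by rewrite -(subrr (complex.Im z)); apply: cvgB => //; exact: cvg_cst.
apply: (squeeze_cvgr _ (cvg_cst 0) h); near=> n.
by rewrite cmod_ge0 cmod_le_ReIm.
Unshelve. all: by end_near. Qed.

End ComplexModulus.

Lemma cvg_shift_addl (R : realType) N (u : nat -> R) (l : R) :
  u @ \oo --> l -> u (N + n)%N @[n --> \oo] --> l.
Proof.
move=> ul; rewrite (_ : (fun n => u (N + n)%N) = [sequence u (n + N)%N]_n).
  by rewrite cvg_shiftn.
by apply/funext => n; rewrite addnC.
Qed.

Lemma telescope_cvg (R : realType) (u d : nat -> R) : cvgn (series d) ->
  (forall n, `|u n.+1 - u n| <= d n) -> cvgn u.
Proof.
move=> cd ud; have c : cvgn (series (telescope u)).
  apply: normed_cvg; apply: (series_le_cvg _ _ _ cd) => n; last exact: ud.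
    exact: normr_ge0.
  exact: le_trans (ud n).
have -> : u = (fun n => u 0%N + series (telescope u) n).
  by apply/funext => n; exact: eq_sum_telescope.
by apply: is_cvgD => //; exact: is_cvg_cst.
Qed.

Section AlmostEverywhereConvergence.
Context d (T : measurableType d) (R : realType) (mu : {measure set T -> \bar R}).
Variables (D : set T) (mD : measurable D).

Lemma Rintegral_dominated (f_ : nat -> T -> R) (f k : T -> R) :
  (forall n, measurable_fun D (f_ n)) -> measurable_fun D f ->
  mu.-integrable D (EFin \o k) ->
  {ae mu, forall t, D t -> f_ ^~ t @ \oo --> f t} ->
  {ae mu, forall t, D t -> forall n, `|f_ n t| <= k t} ->
  \int[mu]_(t in D) `|f_ n t - f t| @[n --> \oo] --> 0.
Proof.
move=> mf_ mf ik f_f f_k.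
have [|||//||_ h _] := @dominated_convergence _ _ R mu D mD
  (fun n => EFin \o f_ n) (EFin \o f) (EFin \o k).
- by move=> n; exact/measurable_EFinP.
- exact/measurable_EFinP.
- apply: filterS f_f => t f_ft Dt; apply: cvg_EFin; last exact: f_ft.
  by near=> n.
- by apply: filterS f_k => t f_kt n Dt; rewrite /= lee_fin; exact: f_kt.
by move/fine_cvgP : h => [].
Unshelve. all: by end_near. Qed.

Lemma measurable_fun_limn_einf (f_ : nat -> T -> \bar R) :
  (forall n, measurable_fun D (f_ n)) ->
  measurable_fun D (fun t => limn_einf (f_ ^~ t)).
Proof.
move=> mf_.
rewrite (_ : (fun t => _) = (fun t => - limn_esup (fun n => - f_ n t))%E).
  apply: measurableT_comp => //; apply: measurable_fun_limn_esup => n.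
  exact: measurableT_comp.
apply/funext => t; rewrite -limn_einfN; congr limn_einf.
by apply/funext => n; rewrite /= oppeK.
Qed.

Lemma Rintegral_fatou (f_ : nat -> T -> R) (f : T -> R) (c : R) :
  (forall n, mu.-integrable D (EFin \o f_ n)) -> (forall n t, 0 <= f_ n t) ->
  (forall n, \int[mu]_(t in D) f_ n t <= c) ->
  measurable_fun D f -> (forall t, 0 <= f t) ->
  {ae mu, forall t, D t -> f_ ^~ t @ \oo --> f t} ->
  mu.-integrable D (EFin \o f) /\ \int[mu]_(t in D) f t <= c.
Proof.
move=> if_ f_0 f_c mf f0 f_f.
have mf_ n : measurable_fun D (EFin \o f_ n) := measurable_int _ (if_ n).
have f_0' n t : D t -> (0 <= (EFin \o f_ n) t)%E by rewrite lee_fin.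
have fE : (\int[mu]_(t in D) (f t)%:E =
    \int[mu]_(t in D) limn_einf (fun n => (f_ n t)%:E))%E.
  apply: ge0_ae_eq_integral => //.
  - exact/measurable_EFinP.
  - exact: measurable_fun_limn_einf.
  - by move=> t _; rewrite lee_fin.
  - move=> t Dt; rewrite limn_einf_lim; apply: lime_ge; first exact: is_cvg_einfs.
    by apply: nearW => n; apply: le_ereal_inf_tmp => _ [m _ <-]; exact: f_0'.
  apply: filterS f_f => t f_ft Dt.
  have [|-> _ //] := @cvg_limn_einf_sup R (fun n => (f_ n t)%:E) (f t)%:E.
  by apply: cvg_EFin; [exact: nearW|exact: f_ft].
have fc : (\int[mu]_(t in D) (f t)%:E <= c%:E)%E.
  rewrite fE; apply: (le_trans (fatou mu mD mf_ f_0')).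
  rewrite limn_einf_lim; apply: lime_le; first exact: is_cvg_einfs.
  apply: nearW => n; apply: (@le_trans _ _ (\int[mu]_(t in D) (f_ n t)%:E)%E).
    by apply: ereal_inf_lbound; exists n => //=.
  rewrite -[leLHS]fineK ?lee_fin; first exact: f_c.
  exact: (integrable_fin_num mD (if_ n)).
have iff : mu.-integrable D (EFin \o f).
  apply/integrableP; split; first exact/measurable_EFinP.
  under eq_integral => t _ do rewrite /= ger0_norm//.
  by apply: le_lt_trans fc _; exact: ltry.
split => //; rewrite -lee_fin fineK//; exact: (integrable_fin_num mD iff).
Qed.

Lemma ae_cvg_series (d_ : nat -> T -> R) (K : R) :
  (forall n, mu.-integrable D (EFin \o d_ n)) -> (forall n t, 0 <= d_ n t) ->
  (forall n, \sum_(0 <= i < n) \int[mu]_(t in D) d_ i t <= K) ->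
  {ae mu, forall t, D t -> cvgn (series (d_ ^~ t))}.
Proof.
move=> id d0 dK; pose S t := (\sum_(0 <= n <oo) (d_ n t)%:E)%E.
have md n : measurable_fun D (EFin \o d_ n) := measurable_int _ (id n).
have S0 t : (0 <= S t)%E by apply: nneseries_ge0 => n _ _; rewrite lee_fin.
have iS : mu.-integrable D S.
  apply/integrableP; split.
    by apply: ge0_emeasurable_sum => [n t _ _|n _]; [rewrite lee_fin|exact: md].
  under eq_integral => t _ do rewrite gee0_abs//.
  rewrite integral_nneseries//; last by move=> n t _; rewrite lee_fin.
  apply: (@le_lt_trans _ _ K%:E); last exact: ltry.
  apply: lime_le.
    by apply: is_cvg_nneseries => n _ _; apply: integral_ge0 => t _; rewrite lee_fin.
  apply: nearW => n; rewrite (eq_bigr (fun i => (\int[mu]_(t in D) d_ i t)%:E)) => [|i _].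
    by rewrite sumEFin lee_fin.
  by rewrite fineK//; exact: (integrable_fin_num mD (id i)).
have := integrable_ae mD iS; apply: filterS => t Sfin Dt.
apply: nondecreasing_is_cvgn; first by apply: nondecreasing_series => n _ _; exact: d0.
exists (fine (S t)) => _ [n _ <-]; rewrite -lee_fin fineK; last exact: Sfin.
rewrite /series /= -sumEFin; apply: nneseries_lim_ge => k _ _.
by rewrite lee_fin.
Qed.

(* The limit is taken as an upper limit so as to be measurable everywhere, not only
   where the sequence converges. *)
Lemma ae_cvg_measurable (f_ : nat -> T -> R) : (forall n, measurable_fun D (f_ n)) ->
  {ae mu, forall t, D t -> cvgn (f_ ^~ t)} ->
  exists2 f : T -> R, measurable_fun D f &
    {ae mu, forall t, D t -> f_ ^~ t @ \oo --> f t}.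
Proof.
move=> mf_ cf_; exists (fun t => fine (limn_esup (fun n => (f_ n t)%:E))).
  apply: (measurableT_comp (f := fine)); first exact: fine_measurable.
  by apply: measurable_fun_limn_esup => n; exact/measurable_EFinP.
apply: filterS cf_ => t cf_t Dt; have /cvg_ex[l cl] := cf_t Dt.
have [//|_ ->//] := @cvg_limn_einf_sup R (fun n => (f_ n t)%:E) l%:E.
by apply: cvg_EFin => //; exact: nearW.
Qed.

End AlmostEverywhereConvergence.

Section CircleIntegrals.
Variable R : realType.
Local Notation mu := (@lebesgue_measure R).
Local Notation I := (@I01 R).
Implicit Types (f g k : R -> R) (c : R).

#[global] Instance ae01_filter : Filter (@ae01 R).
Proof.
split=> [|P Q aP aQ|P Q PQ aP]; first exact: aeW.
- by apply: (filterS2 (F := almost_everywhere mu)) aP aQ => t tP tQ It; split; auto.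
- by apply: (filterS (F := almost_everywhere mu)) aP => t tP It; exact/PQ/tP.
Qed.

Lemma ae01_forall (P : nat -> R -> Prop) : (forall n, ae01 (P n)) ->
  ae01 (fun t => forall n, P n t).
Proof.
move=> aP; have := ae_foralln aP.
by apply: (filterS (F := almost_everywhere mu)) => t tP It n; exact: tP.
Qed.

Lemma ae01_in : ae01 (fun t : R => 0 <= t <= 1).
Proof. by apply: aeW => t; rewrite /I01 /= in_itv. Qed.

Lemma ae01_neq (a : R) : ae01 (fun t => t <> a).
Proof.
exists [set a]; split; first exact: measurable_set1.
  exact: lebesgue_measure_set1.
by move=> t /= /not_implyP[_] /contrapT.
Qed.

(* [R] carries two convertible measurable structures, [measurableTypeR R] being the one
   on which [lebesgue_measure] lives; hints do not see through the difference. *)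
Lemma measurable_I01 : measurable I. Proof. exact: measurable_itv. Qed.

Lemma measurable_I01_lebesgue : measurable (I : set (measurableTypeR R)).
Proof. exact: measurable_itv. Qed.

Local Hint Resolve measurable_I01 measurable_I01_lebesgue : core.

Lemma measure_I01 : mu I = 1%E.
Proof. by rewrite lebesgue_measure_itv /= lte_fin ltr01 oppr0 adde0. Qed.

Definition integrable01 f : Prop := mu.-integrable I (EFin \o f).

Definition mean f : R := \int[mu]_(t in I) f t.

Lemma integrable01_measurable f : integrable01 f -> measurable_fun I f.
Proof. by move=> /measurable_int /measurable_EFinP. Qed.

Lemma integrable01_norm f : integrable01 f -> integrable01 (fun t => `|f t|).
Proof. by move=> hf; have := integrable_norm hf. Qed.

Lemma integrable01D f g : integrable01 f -> integrable01 g ->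
  integrable01 (fun t => f t + g t).
Proof. by move=> hf hg; have := integrableD measurable_I01_lebesgue hf hg. Qed.

Lemma integrable01Z c f : integrable01 f -> integrable01 (fun t => c * f t).
Proof. by move=> hf; have := integrableZl measurable_I01_lebesgue c hf. Qed.

Lemma integrable01B f g : integrable01 f -> integrable01 g ->
  integrable01 (fun t => f t - g t).
Proof. by move=> hf hg; have := integrableB measurable_I01_lebesgue hf hg. Qed.

Lemma integrable01_cst c : integrable01 (fun=> c).
Proof.
apply/integrableP; split; first exact: measurable_cst.
by rewrite /= integral_cst//= measure_I01 mule1 ltry.
Qed.

Lemma integrable01_le f k : measurable_fun I f -> integrable01 k ->
  ae01 (fun t => `|f t| <= k t) -> integrable01 f.
Proof.
move=> mf ik fk; apply/integrableP; split; first exact/measurable_EFinP.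
have /integrableP[mk] := ik.
apply: le_lt_trans; apply: ae_ge0_le_integral => //.
- by apply: measurableT_comp => //; exact/measurable_EFinP.
- exact: measurableT_comp.
apply: (filterS (F := almost_everywhere mu)) fk => t fk It; rewrite /= lee_fin.
by apply: le_trans (fk It) _; exact: ler_norm.
Qed.

Lemma integrable01_mul_bounded f k : measurable_fun I f -> ae01 (fun t => `|f t| <= 1) ->
  integrable01 k -> integrable01 (fun t => f t * k t).
Proof.
move=> mf f1 ik; apply: (integrable01_le _ (integrable01_norm ik)).
  by apply: measurable_funM => //; exact: integrable01_measurable.
by apply: filterS f1 => t ft; rewrite normrM ler_piMl.
Qed.

Lemma meanD f g : integrable01 f -> integrable01 g ->
  mean (fun t => f t + g t) = mean f + mean g.
Proof. by move=> hf hg; rewrite /mean RintegralD. Qed.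

Lemma meanB f g : integrable01 f -> integrable01 g ->
  mean (fun t => f t - g t) = mean f - mean g.
Proof. by move=> hf hg; rewrite /mean RintegralB. Qed.

Lemma meanZ c f : integrable01 f -> mean (fun t => c * f t) = c * mean f.
Proof. by move=> hf; rewrite /mean RintegralZl. Qed.

Lemma mean_cst c : mean (fun=> c) = c.
Proof.
have := @Rintegral_cst _ _ R mu I measurable_I01_lebesgue.
by move=> /(_ c); rewrite (_ : fine _ = 1) ?mulr1//; exact: (congr1 fine measure_I01).
Qed.

Lemma ae_eq_mean f g : measurable_fun I f -> measurable_fun I g ->
  ae01 (fun t => f t = g t) -> mean f = mean g.
Proof.
move=> mf mg fg; congr fine; apply: ae_eq_integral => //; try exact/measurable_EFinP.
by apply: (filterS (F := almost_everywhere mu)) fg => t fg It /=; rewrite fg.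
Qed.

Lemma ler_mean f g : integrable01 f -> integrable01 g ->
  ae01 (fun t => f t <= g t) -> mean f <= mean g.
Proof.
move=> hf hg fg; pose k t := Num.max (f t) (g t).
have mf := integrable01_measurable hf; have mg := integrable01_measurable hg.
have mk : measurable_fun I k by exact: measurable_maxr.
have gk : ae01 (fun t => g t = k t).
  by apply: filterS fg => t h; exact/esym/max_idPr.
have ik : integrable01 k.
  by apply: (integrable01_le mk (integrable01_norm hg)); apply: filterS gk => t <-.
rewrite (ae_eq_mean mg mk gk).
by apply: le_Rintegral => // t _; rewrite /k le_max lexx.
Qed.

Lemma mean_ge0 f : (forall t, 0 <= f t) -> 0 <= mean f.
Proof. by move=> f0; apply: Rintegral_ge0 => t _; exact: f0. Qed.

Lemma mean_eq0 f : integrable01 f -> (forall t, 0 <= f t) -> mean f = 0 ->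
  ae01 (fun t => f t = 0).
Proof.
move=> hf f0 mf0; have mf : measurable_fun (I : set (measurableTypeR R)) (EFin \o f).
  exact: measurable_int hf.
have h : (\int[mu]_(t in I) `|(f t)%:E|)%E = 0%E.
  under eq_integral => t _ do rewrite gee0_abs ?lee_fin//.
  rewrite -[LHS]fineK; first by rewrite -[fine _]/(mean f) mf0.
  exact: (integrable_fin_num measurable_I01_lebesgue hf).
move/(ae_eq_integral_abs mu measurable_I01_lebesgue mf): h.
by apply: (filterS (F := almost_everywhere mu)) => t h It; have [] := h It.
Qed.

Lemma ler_norm_mean f : integrable01 f -> `|mean f| <= mean (fun t => `|f t|).
Proof. by move=> hf; exact: le_normr_Rintegral. Qed.

Lemma ae01_cvg_series_geometric (f_ : nat -> R -> R) c :
  (forall n, integrable01 (f_ n)) -> (forall n t, 0 <= f_ n t) ->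
  (forall n, mean (f_ n) <= c * 2^-1 ^+ n) -> ae01 (fun t => cvgn (series (f_ ^~ t))).
Proof.
move=> if_ f_0 f_c; have c0 : 0 <= c.
  by apply: le_trans (mean_ge0 (f_0 0%N)) _; have := f_c 0%N; rewrite expr0 mulr1.
apply: (ae_cvg_series measurable_I01_lebesgue (K := 2 * c)) => // n.
apply: (@le_trans _ _ (series (geometric c 2^-1) n)); first exact: ler_sum.
rewrite geometric_seriesE ?lt_eqF ?invf_lt1 ?ltr1n//=.
rewrite (_ : 1 - 2^-1 = 2^-1 :> R) ?invrK; last by field.
by rewrite mulrC ler_wpM2l// ler_piMr// gerBl exprn_ge0// invr_ge0.
Qed.

Lemma ae01_cvg_telescope (f_ d : nat -> R -> R) : (forall n, measurable_fun I (f_ n)) ->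
  ae01 (fun t => cvgn (series (d ^~ t))) ->
  (forall n t, `|f_ n.+1 t - f_ n t| <= d n t) ->
  exists2 f : R -> R, measurable_fun I f & ae01 (fun t => f_ ^~ t @ \oo --> f t).
Proof.
move=> mf_ cd f_d; apply: (@ae_cvg_measurable _ _ R mu I) => //.
apply: (filterS (F := almost_everywhere _)) cd => t cd It.
exact: (telescope_cvg (cd It)).
Qed.

Lemma measurable_invr_ge0 f : measurable_fun I f -> (forall t, 0 <= f t) ->
  measurable_fun I (fun t => (f t)^-1).
Proof.
move=> mf f0; rewrite (_ : (fun t => _) = (@powR R ^~ (- 1)) \o f).
  by apply: measurableT_comp => //; exact: measurable_powR.
by apply/funext => t /=; rewrite powR_inv1.
Qed.

Lemma measurable_sqrtr f : measurable_fun I f ->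
  measurable_fun I (fun t => Num.sqrt (f t)).
Proof.
move=> mf; apply: (measurableT_comp (f := @Num.sqrt R)) => //.
by apply: continuous_measurable_fun; exact: sqrt_continuous.
Qed.

Lemma mean_FTC (f F : R -> R) : continuous f -> (forall t : R, is_derive t 1 F (f t)) ->
  mean f = F 1 - F 0.
Proof.
move=> cf dF; have cF : continuous F.
  by move=> t; apply/differentiable_continuous/derivable1_diffP; exact: ex_derive.
rewrite /mean /Rintegral (@continuous_FTC2 R f F 0 1 ltr01 (continuous_subspaceT cf))//.
  split; first by move=> t _; exact: ex_derive.
  - exact/cvg_at_right_filter/cF.
  - exact/cvg_at_left_filter/cF.
by move=> t _; rewrite derive1E derive_val.
Qed.

End CircleIntegrals.
#[global] Hint Resolve measurable_I01 measurable_I01_lebesgue : core.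

Section ComplexIntegrals.
Variable R : realType.
Local Notation C := R[i].
Local Notation I := (@I01 R).
Implicit Types (f g : R -> C) (k : R -> R) (c : C).

Lemma cmeasurable_cst c : cmeasurable (fun _ : R => c).
Proof. by split; exact: measurable_cst. Qed.

Lemma cmeasurable_real k : measurable_fun I k -> cmeasurable (fun t => (k t)%:C).
Proof. by split => //=; exact: measurable_cst. Qed.

Lemma cmeasurableD f g : cmeasurable f -> cmeasurable g ->
  cmeasurable (fun t => f t + g t).
Proof.
move=> [rf jf] [rg jg]; split; under eq_fun do rewrite raddfD.
  exact: measurable_funD.
exact: measurable_funD.
Qed.

Lemma cmeasurableM f g : cmeasurable f -> cmeasurable g ->
  cmeasurable (fun t => f t * g t).
Proof.
move=> [rf jf] [rg jg]; split.
  by under eq_fun do rewrite Re_mulc; apply: measurable_funB; exact: measurable_funM.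
by under eq_fun do rewrite Im_mulc; apply: measurable_funD; exact: measurable_funM.
Qed.

Lemma cmeasurableZ c f : cmeasurable f -> cmeasurable (fun t => c * f t).
Proof. by apply: cmeasurableM; exact: cmeasurable_cst. Qed.

Lemma cmeasurableN f : cmeasurable f -> cmeasurable (fun t => - f t).
Proof. by move=> /(cmeasurableZ (-1)); apply: eq_fun_pred => t; rewrite mulN1r. Qed.

Lemma cmeasurableB f g : cmeasurable f -> cmeasurable g ->
  cmeasurable (fun t => f t - g t).
Proof. by move=> mf mg; apply: cmeasurableD => //; exact: cmeasurableN. Qed.

Lemma cmeasurableX f n : cmeasurable f -> cmeasurable (fun t => f t ^+ n).
Proof.
move=> mf; elim: n => [|n ih]; first exact: (cmeasurable_cst 1).
by under eq_fun do rewrite exprS; exact: cmeasurableM.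
Qed.

Lemma cmeasurable_conjc f : cmeasurable f -> cmeasurable (fun t => conjc (f t)).
Proof.
move=> [rf jf]; split; first by under eq_fun do rewrite Re_conjc.
by under eq_fun do rewrite Im_conjc; exact: measurable_funN.
Qed.

Lemma measurable_cmod f : cmeasurable f -> measurable_fun I (fun t => cmod (f t)).
Proof.
by move=> [rf jf]; apply: measurable_sqrtr; apply: measurable_funD;
  exact: measurable_funX.
Qed.

Lemma cmeasurableV f : cmeasurable f -> cmeasurable (fun t => (f t)^-1).
Proof.
move=> mf; under eq_fun do rewrite invc_cmod.
apply: cmeasurableM; last exact: cmeasurable_conjc.
apply: cmeasurable_real; apply: measurable_invr_ge0 => [|t]; last exact: sqr_ge0.
by apply: measurable_funX; exact: measurable_cmod.
Qed.

Lemma cmeasurable_zpow (n : int) : cmeasurable (@zpow R n).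
Proof.
have mt : measurable_fun I (fun t : R => 2 * pi * n%:~R * t).
  by apply: measurable_funM => //; exact: measurable_cst.
split=> /=; first apply: (measurableT_comp (f := @cos R)) => //.
  exact: (continuous_measurable_fun (@continuous_cos R)).
apply: (measurableT_comp (f := @sin R)) => //.
exact: (continuous_measurable_fun (@continuous_sin R)).
Qed.

Lemma L1P f : L1 f <-> cmeasurable f /\ integrable01 (fun t => cmod (f t)).
Proof.
split=> [[mf hf]|[mf /integrableP[_ hf]]]; split => //.
  apply/integrableP; split; first by apply/measurable_EFinP; exact: measurable_cmod.
  by under eq_integral => t _ do rewrite /= ger0_norm ?cmod_ge0//.
by move: hf; under eq_integral => t _ do rewrite /= ger0_norm ?cmod_ge0//.
Qed.

Lemma L1_cmeasurable f : L1 f -> cmeasurable f. Proof. by case. Qed.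

Lemma integrable01_cmod f : L1 f -> integrable01 (fun t => cmod (f t)).
Proof. by move=> /L1P[]. Qed.

Lemma L1_le f k : cmeasurable f -> integrable01 k ->
  ae01 (fun t => cmod (f t) <= k t) -> L1 f.
Proof.
move=> mf ik fk; apply/L1P; split => //.
apply: (integrable01_le _ ik); first exact: measurable_cmod.
by apply: filterS fk => t; rewrite ger0_norm// cmod_ge0.
Qed.

Lemma integrable01_Re f : L1 f -> integrable01 (fun t => complex.Re (f t)).
Proof.
move=> hf; apply: (integrable01_le _ (integrable01_cmod hf)); first by case: hf => -[].
by apply: filterE => t; exact: normr_Re_le.
Qed.

Lemma integrable01_Im f : L1 f -> integrable01 (fun t => complex.Im (f t)).
Proof.
move=> hf; apply: (integrable01_le _ (integrable01_cmod hf)); first by case: hf => -[].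
by apply: filterE => t; exact: normr_Im_le.
Qed.

Lemma L1D f g : L1 f -> L1 g -> L1 (fun t => f t + g t).
Proof.
move=> hf hg.
apply: (L1_le _ (integrable01D (integrable01_cmod hf) (integrable01_cmod hg))).
  by apply: cmeasurableD; exact: L1_cmeasurable.
by apply: filterE => t; exact: ler_cmodD.
Qed.

Lemma L1_mul_bounded f g (M : R) : cmeasurable g -> ae01 (fun t => cmod (g t) <= M) ->
  L1 f -> L1 (fun t => g t * f t).
Proof.
move=> mg gM hf; apply: (L1_le _ (integrable01Z M (integrable01_cmod hf))).
  by apply: cmeasurableM => //; exact: L1_cmeasurable.
by apply: filterS gM => t h; rewrite cmodM ler_wpM2r// cmod_ge0.
Qed.

Lemma L1Z c f : L1 f -> L1 (fun t => c * f t).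
Proof.
by apply: (L1_mul_bounded (M := cmod c)); [exact: cmeasurable_cst|exact: filterE].
Qed.

Lemma L1N f : L1 f -> L1 (fun t => - f t).
Proof. by move=> /(L1Z (-1)); apply: eq_fun_pred => t; rewrite mulN1r. Qed.

Lemma L1B f g : L1 f -> L1 g -> L1 (fun t => f t - g t).
Proof. by move=> hf hg; apply: L1D => //; exact: L1N. Qed.

Lemma L1_conjc f : L1 f -> L1 (fun t => conjc (f t)).
Proof.
move=> hf; apply: (L1_le _ (integrable01_cmod hf)).
  exact/cmeasurable_conjc/L1_cmeasurable.
by apply: filterE => t; rewrite cmod_conjc.
Qed.

Lemma L1_real k : integrable01 k -> L1 (fun t => (k t)%:C).
Proof.
move=> ik; apply: (L1_le _ (integrable01_norm ik)).
  by apply: cmeasurable_real; exact: integrable01_measurable.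
by apply: filterE => t; rewrite cmod_real.
Qed.

Lemma L1_bounded f (M : R) : cmeasurable f -> ae01 (fun t => cmod (f t) <= M) -> L1 f.
Proof. by move=> mf; exact: (L1_le mf (integrable01_cst M)). Qed.

Lemma L1_cst c : L1 (fun _ : R => c).
Proof. by apply: (L1_bounded (cmeasurable_cst c)); exact: filterE. Qed.

Lemma L1_ae f g : L1 f -> cmeasurable g -> ae01 (fun t => f t = g t) -> L1 g.
Proof.
by move=> hf mg fg; apply: (L1_le mg (integrable01_cmod hf)); apply: filterS fg => t ->.
Qed.

Definition cmean f : C :=
  Complex (mean (fun t => complex.Re (f t))) (mean (fun t => complex.Im (f t))).

Lemma cmeanD f g : L1 f -> L1 g -> cmean (fun t => f t + g t) = cmean f + cmean g.
Proof.
move=> hf hg; apply: eq_ReIm; rewrite raddfD /= -meanD;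
  by [congr mean; apply/funext => t; rewrite raddfD
     |exact: integrable01_Re|exact: integrable01_Im].
Qed.

Lemma cmeanZ c f : L1 f -> cmean (fun t => c * f t) = c * cmean f.
Proof.
move=> hf; have hr := integrable01_Re hf; have hi := integrable01_Im hf.
apply: eq_ReIm; rewrite ?Re_mulc ?Im_mulc /= -!meanZ // -?meanB -?meanD;
  try exact: integrable01Z.
  by congr mean; apply/funext => t; rewrite Re_mulc.
by congr mean; apply/funext => t; rewrite Im_mulc.
Qed.

Lemma cmeanB f g : L1 f -> L1 g -> cmean (fun t => f t - g t) = cmean f - cmean g.
Proof.
move=> hf hg; rewrite -[- cmean g]mulN1r -cmeanZ// -cmeanD//; last exact: L1Z.
by congr cmean; apply/funext => t; rewrite mulN1r.
Qed.

Lemma cmean_conjc f : L1 f -> cmean (fun t => conjc (f t)) = conjc (cmean f).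
Proof.
move=> hf; apply: eq_ReIm => /=; first by congr mean; apply/funext => t; rewrite Re_conjc.
rewrite -mulN1r -meanZ; last exact: integrable01_Im.
by congr mean; apply/funext => t; rewrite Im_conjc mulN1r.
Qed.

Lemma ae_eq_cmean f g : cmeasurable f -> cmeasurable g -> ae01 (fun t => f t = g t) ->
  cmean f = cmean g.
Proof.
move=> [rf jf] [rg jg] fg; apply: eq_ReIm => /=; apply: ae_eq_mean => //;
  by apply: filterS fg => t ->.
Qed.

Lemma cmean_real k : cmean (fun t => (k t)%:C) = (mean k)%:C.
Proof. by apply: eq_ReIm => //=; exact: mean_cst. Qed.

Lemma cmean_cst c : cmean (fun=> c) = c.
Proof. by apply: eq_ReIm => /=; exact: mean_cst. Qed.

Lemma norm1_ge0 f : 0 <= norm1 f.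
Proof. by apply: mean_ge0 => t; exact: cmod_ge0. Qed.

Lemma norm1E f : norm1 f = mean (fun t => cmod (f t)). Proof. by []. Qed.

Lemma norm1_cst c : norm1 (fun _ : R => c) = cmod c.
Proof. exact: mean_cst. Qed.

Lemma ae_eq_norm1 f g : cmeasurable f -> cmeasurable g ->
  ae01 (fun t => cmod (f t) = cmod (g t)) -> norm1 f = norm1 g.
Proof. by move=> mf mg fg; apply: ae_eq_mean => //; exact: measurable_cmod. Qed.

Lemma ler_norm1 f g : L1 f -> L1 g -> ae01 (fun t => cmod (f t) <= cmod (g t)) ->
  norm1 f <= norm1 g.
Proof. by move=> hf hg; apply: ler_mean; exact: integrable01_cmod. Qed.

Lemma norm1_eq0 f : L1 f -> norm1 f = 0 -> ae01 (fun t => f t = 0).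
Proof.
move=> hf /(mean_eq0 (integrable01_cmod hf)) f0.
by apply: filterS (f0 _) => [t|t]; [exact: cmod0_eq0 | exact: cmod_ge0].
Qed.

Lemma norm1_small f : L1 f -> (forall e, 0 < e -> norm1 f <= e) ->
  ae01 (fun t => f t = 0).
Proof.
move=> hf fe; apply: norm1_eq0 => //; apply/eqP; rewrite eq_le norm1_ge0 andbT.
by apply/ler_addgt0Pl => e e0; rewrite addr0; exact: fe.
Qed.

Lemma norm1D f g : L1 f -> L1 g -> norm1 (fun t => f t + g t) <= norm1 f + norm1 g.
Proof.
move=> hf hg; rewrite -meanD; try exact: integrable01_cmod.
apply: ler_mean; first by apply/integrable01_cmod/L1D.
  by apply: integrable01D; exact: integrable01_cmod.
by apply: filterE => t; exact: ler_cmodD.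
Qed.

Lemma norm1Z c f : L1 f -> norm1 (fun t => c * f t) = cmod c * norm1 f.
Proof.
move=> hf; rewrite -meanZ; last exact: integrable01_cmod.
by congr mean; apply/funext => t; rewrite cmodM.
Qed.

Lemma norm1_half_sum_le f g : L1 f -> L1 g ->
  norm1 (fun t => (f t + g t) / 2) <= (norm1 f + norm1 g) / 2.
Proof.
move=> hf hg; rewrite (_ : (fun t => _) = (fun t => 2^-1 * (f t + g t))); last first.
  by apply/funext => t; rewrite mulrC.
rewrite norm1Z; last exact: L1D.
rewrite -realC2V cmod_real ger0_norm ?invr_ge0// mulrC ler_wpM2r ?invr_ge0//.
exact: norm1D.
Qed.

(* The constant is not sharp: real and imaginary parts are estimated separately. *)
Lemma cmod_cmean_le f : L1 f -> cmod (cmean f) <= 2 * norm1 f.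
Proof.
move=> hf; apply: le_trans (cmod_le_ReIm _) _ => /=.
rewrite mulr_natl mulr2n; apply: lerD.
  apply: le_trans (ler_norm_mean (integrable01_Re hf)) _; apply: ler_mean.
  - exact/integrable01_norm/integrable01_Re.
  - exact: integrable01_cmod.
  by apply: filterE => t; exact: normr_Re_le.
apply: le_trans (ler_norm_mean (integrable01_Im hf)) _; apply: ler_mean.
- exact/integrable01_norm/integrable01_Im.
- exact: integrable01_cmod.
by apply: filterE => t; exact: normr_Im_le.
Qed.

Definition bounded_limit (w_ : nat -> R -> C) (w : R -> C) : Prop :=
  [/\ forall n, cmeasurable (w_ n), cmeasurable w,
      exists M, ae01 (fun t => forall n, cmod (w_ n t) <= M)
    & ae01 (fun t => cmod (w_ n t - w t) @[n --> \oo] --> (0 : R))].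

Lemma bounded_limit_bounded w_ w : bounded_limit w_ w ->
  exists M, ae01 (fun t => cmod (w t) <= M).
Proof.
move=> [_ _ [M w_M] w_w]; exists M; apply: filterS2 w_M w_w => t w_tM /cvg_cmod w_wt.
by rewrite -(cvg_lim (@Rhausdorff R) w_wt); apply: limr_le;
  [exact: cvgP w_wt|exact: nearW].
Qed.

Lemma bounded_limit_L1 w_ w g : bounded_limit w_ w -> L1 g -> L1 (fun t => w t * g t).
Proof.
move=> ww; have [M wM] := bounded_limit_bounded ww; have [_ mw _ _] := ww.
exact: L1_mul_bounded wM.
Qed.

Lemma bounded_limit_approx w_ w g (e : R) : bounded_limit w_ w -> L1 g -> 0 < e ->
  exists n, norm1 (fun t => w t * g t - w_ n t * g t) <= e.
Proof.
move=> ww Lg e0; have [mw_ mw [M w_M] w_w] := ww; have mg := L1_cmeasurable Lg.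
have [N wN] := bounded_limit_bounded ww.
pose d_ n t := cmod (w_ n t * g t - w t * g t).
have d_E n t : d_ n t = cmod (w_ n t - w t) * cmod (g t) by rewrite -cmodM mulrBl.
have md_ n : measurable_fun I (d_ n).
  by apply: measurable_cmod; apply: cmeasurableB; exact: cmeasurableM.
have d_0 : ae01 (fun t => d_ ^~ t @ \oo --> (0 : R)).
  apply: filterS w_w => t /cvgM/(_ (cvg_cst (cmod (g t)))); rewrite mul0r.
  rewrite (_ : d_ ^~ t = (fun n => cmod (w_ n t - w t)) \* (fun=> cmod (g t)))//.
  by apply/funext => n; rewrite d_E.
have d_b : ae01 (fun t => forall n, `|d_ n t| <= (M + N) * cmod (g t)).
  apply: filterS2 w_M wN => t w_t wt n; rewrite d_E ger0_norm ?mulr_ge0 ?cmod_ge0//.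
  by rewrite ler_wpM2r ?cmod_ge0// (le_trans (ler_cmodB _ _))// lerD.
have := Rintegral_dominated (@measurable_I01_lebesgue R) md_
  (measurable_cst (0 : R))
  (integrable01Z (M + N) (integrable01_cmod Lg)) d_0 d_b.
move=> /cvgr0Pnorm_le/(_ e e0)[n _ /(_ n (leqnn n)) h]; exists n.
apply: le_trans (le_trans (ler_norm _) h); rewrite le_eqVlt; apply/orP; left; apply/eqP.
by congr mean; apply/funext => t; rewrite subr0 ger0_norm ?cmod_ge0// /d_ cmodBC.
Qed.

Lemma zpowD (m n : int) (t : R) : zpow (m + n) t = zpow m t * zpow n t.
Proof.
rewrite /zpow intrD mulrDr mulrDl cosD sinD.
by apply: eq_ReIm => //=; rewrite addrC mulrC [X in _ + X]mulrC.
Qed.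

Lemma zpow0 (t : R) : zpow 0 t = 1.
Proof. by rewrite /zpow mulr0z mulr0 mul0r cos0 sin0. Qed.

Lemma zpowK (n : int) (t : R) (z : C) : zpow (- n) t * (zpow n t * z) = z.
Proof. by rewrite mulrA -zpowD addNr zpow0 mul1r. Qed.

Lemma zpowNK (n : int) (t : R) (z : C) : zpow n t * (zpow (- n) t * z) = z.
Proof. by rewrite mulrA -zpowD addrN zpow0 mul1r. Qed.

Lemma conjc_zpow (n : int) (t : R) : conjc (zpow n t) = zpow (- n) t.
Proof. by rewrite /zpow /= rmorphN /= mulrN mulNr cosN sinN. Qed.

Lemma cmod_zpow (n : int) (t : R) : cmod (zpow n t) = 1.
Proof. by rewrite /cmod /= cos2Dsin2 sqrtr1. Qed.

Lemma zpow1_nat (n : nat) : zpow n 1 = 1 :> C.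
Proof.
elim: n => [|n ih]; first exact: zpow0.
rewrite -addn1 PoszD zpowD ih mul1r /zpow mulr1z !mulr1 mulrC mulr_natr.
by rewrite cos2pi sin2pi.
Qed.

Lemma L1_zpow f (n : int) : L1 f -> L1 (fun t => zpow n t * f t).
Proof.
apply: (@L1_mul_bounded _ _ 1); first exact: cmeasurable_zpow.
by apply: filterE => t; rewrite cmod_zpow.
Qed.

Lemma is_derive_scale (a t : R) : is_derive t 1 (fun s : R => a * s) a.
Proof.
have := @is_deriveM R R (cst a) id t 1 0 1 _ _.
by rewrite /= scaler0 addr0 /GRing.scale /= mulr1; apply.
Qed.

Lemma mean_trig (a : R) : a != 0 ->
  mean (fun t => cos (a * t)) = a^-1 * sin a /\
  mean (fun t => sin (a * t)) = a^-1 * (1 - cos a).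
Proof.
move=> a0; have ca : continuous (fun t : R => a * t).
  by move=> t; apply: cvgM; [exact: cvg_cst|exact: cvg_id].
split.
  have -> : a^-1 * sin a = a^-1 * sin (a * 1) - a^-1 * sin (a * 0).
    by rewrite mulr1 mulr0 sin0 mulr0 subr0.
  apply: (@mean_FTC _ _ (fun t => a^-1 * sin (a * t))) => t.
    by apply: continuous_comp; [exact: ca|exact: continuous_cos].
  have ds := @is_derive1_comp R (@sin R) _ t _ _ (is_derive_sin _) (is_derive_scale a t).
  apply: (is_derive_eq (is_deriveM (is_derive_cst a^-1 _ _) ds)).
  by rewrite scaler0 addr0 /GRing.scale /= mulrCA mulVf// mulr1.
have -> : a^-1 * (1 - cos a) = a^-1 * - cos (a * 1) - a^-1 * - cos (a * 0).
  by rewrite mulr1 mulr0 cos0; ring.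
apply: (@mean_FTC _ _ (fun t => a^-1 * - cos (a * t))) => t.
  by apply: continuous_comp; [exact: ca|exact: continuous_sin].
have dc := @is_derive1_comp R (@cos R) _ t _ _ (is_derive_cos _) (is_derive_scale a t).
apply: (is_derive_eq (is_deriveM (is_derive_cst a^-1 _ _) (is_deriveN dc))).
by rewrite scaler0 addr0 /GRing.scale /= mulNr opprK mulrCA mulVf// mulr1.
Qed.

Lemma cmean_zpow (n : nat) : cmean (@zpow R n.+1) = 0.
Proof.
have a0 : 2 * pi * (n.+1 : int)%:~R != 0 :> R.
  by rewrite !mulf_neq0 ?pnatr_eq0 ?intr_eq0// gt_eqF// pi_gt0.
have [mc ms] := mean_trig a0; have := zpow1_nat n.+1; rewrite /zpow mulr1 => -[c1 s1].
by apply: eq_ReIm => /=; rewrite ?mc ?ms ?c1 ?s1 ?subrr mulr0.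
Qed.

Lemma fourierE f (k : int) : fourier f k = cmean (fun t => zpow (- k) t * f t).
Proof.
by apply: eq_ReIm => /=; congr mean; apply/funext => t; rewrite -conjc_zpow.
Qed.

Lemma fourierD f g (k : int) : L1 f -> L1 g ->
  fourier (fun t => f t + g t) k = fourier f k + fourier g k.
Proof.
move=> hf hg; rewrite !fourierE -cmeanD; try exact: L1_zpow.
by congr cmean; apply/funext => t; rewrite mulrDr.
Qed.

Lemma fourierZ c f (k : int) : L1 f -> fourier (fun t => c * f t) k = c * fourier f k.
Proof.
move=> hf; rewrite !fourierE -cmeanZ; last exact: L1_zpow.
by congr cmean; apply/funext => t; rewrite mulrCA.
Qed.

Lemma fourier_zpow f (n k : int) : fourier (fun t => zpow n t * f t) k = fourier f (k - n).
Proof.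
rewrite !fourierE; congr cmean; apply/funext => t.
by rewrite mulrA -zpowD opprB addrC.
Qed.

Lemma fourier_conjc f (k : int) : L1 f ->
  fourier (fun t => conjc (f t)) k = conjc (fourier f (- k)).
Proof.
move=> hf; rewrite !fourierE opprK -cmean_conjc; last exact: L1_zpow.
by congr cmean; apply/funext => t; rewrite conjcM conjc_zpow.
Qed.

Lemma fourier0 f : fourier f 0 = cmean f.
Proof. by rewrite fourierE oppr0; congr cmean; apply/funext => t; rewrite zpow0 mul1r. Qed.

Lemma ae_eq_fourier f g (k : int) : cmeasurable f -> cmeasurable g ->
  ae01 (fun t => f t = g t) -> fourier f k = fourier g k.
Proof.
move=> mf mg fg; rewrite !fourierE; apply: ae_eq_cmean.
- by apply: cmeasurableM => //; exact: cmeasurable_zpow.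
- by apply: cmeasurableM => //; exact: cmeasurable_zpow.
by apply: filterS fg => t ->.
Qed.

(* [H1] is the case [K = [set k | k < 0]]. *)
Definition L1_vanish_on (K : set int) f : Prop :=
  L1 f /\ forall k : int, K k -> fourier f k = 0.

Lemma L1_vanish_onD K f g : L1_vanish_on K f -> L1_vanish_on K g ->
  L1_vanish_on K (fun t => f t + g t).
Proof.
move=> [hf cf] [hg cg]; split=> [|k Kk]; first exact: L1D.
by rewrite fourierD// cf// cg// addr0.
Qed.

Lemma L1_vanish_onZ K c f : L1_vanish_on K f -> L1_vanish_on K (fun t => c * f t).
Proof.
move=> [hf cf]; split=> [|k Kk]; first exact: L1Z.
by rewrite fourierZ// cf// mulr0.
Qed.

Lemma L1_vanish_on_ae K f g : L1_vanish_on K f -> cmeasurable g ->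
  ae01 (fun t => f t = g t) -> L1_vanish_on K g.
Proof.
move=> [hf cf] mg fg; split=> [|k Kk]; first exact: L1_ae fg.
by rewrite -(ae_eq_fourier k (L1_cmeasurable hf) mg fg) cf.
Qed.

Lemma L1_vanish_on_closed K f : L1 f ->
  (forall e, 0 < e -> exists2 g, L1_vanish_on K g & norm1 (fun t => f t - g t) <= e) ->
  L1_vanish_on K f.
Proof.
move=> Lf fe; split=> // k Kk; apply/cmod0_eq0/eqP; rewrite eq_le cmod_ge0 andbT.
apply/ler_addgt0Pl => e e0; rewrite addr0.
have [g [Lg gK] ng] := fe (e / 2) (divr_gt0 e0 (ltr0Sn _ 1)).
rewrite -[fourier f k]subr0 -(gK k Kk) !fourierE -cmeanB; try exact: L1_zpow.
under eq_fun do rewrite -mulrBr.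
have Lfg := L1B Lf Lg; have Lzfg := L1_zpow (- k) Lfg.
apply: le_trans (cmod_cmean_le Lzfg) _; rewrite -ler_pdivlMl// mulrC.
apply: le_trans ng; apply: (ler_norm1 Lzfg Lfg).
by apply: filterE => t; rewrite cmodM cmod_zpow mul1r.
Qed.

Lemma L1_vanish_on_bounded_limit K w_ w g : bounded_limit w_ w -> L1 g ->
  (forall n, L1_vanish_on K (fun t => w_ n t * g t)) ->
  L1_vanish_on K (fun t => w t * g t).
Proof.
move=> ww Lg w_K; apply: L1_vanish_on_closed => [|e e0].
  exact: bounded_limit_L1 ww Lg.
by have [n] := bounded_limit_approx ww Lg e0; exists (fun t => w_ n t * g t).
Qed.

End ComplexIntegrals.

Section StepPolynomials.
Variable R : realType.
Implicit Types (y a : R).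

(* The Stone-Weierstrass step polynomials: they tend to the indicator of [y < 1/2]
   boundedly on [0, 1], away from [y = 1/2]. *)
Definition step_poly n y : R := (1 - y ^+ n) ^+ (2 ^ n).

Lemma bernoulli_ineq a m : -1 <= a -> 1 + m%:R * a <= (1 + a) ^+ m.
Proof.
move=> a1; elim: m => [|m ih]; first by rewrite mul0r addr0 expr0.
rewrite exprS; apply: (@le_trans _ _ ((1 + a) * (1 + m%:R * a))); last first.
  by apply: ler_wpM2l ih; lra.
rewrite -natr1 (_ : (1 + a) * _ = 1 + (m%:R + 1) * a + m%:R * a ^+ 2); last by ring.
by rewrite lerDl mulr_ge0 ?sqr_ge0.
Qed.

Lemma expr_onem_le a m : 0 <= a <= 1 -> m%:R * a * (1 - a) ^+ m <= 1.
Proof.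
move=> /andP[a0 a1]; have am : 0 <= (1 - a) ^+ m by apply: exprn_ge0; lra.
have ma : m%:R * a <= (1 + a) ^+ m by have := @bernoulli_ineq a m; lra.
apply: (le_trans (ler_wpM2r am ma)); rewrite -exprMn.
by apply: exprn_ile1; nra.
Qed.

Lemma step_poly_itv n y : 0 <= y <= 1 -> 0 <= step_poly n y <= 1.
Proof.
move=> /andP[y0 y1]; have yn0 := exprn_ge0 n y0; have yn1 := exprn_ile1 n y0 y1.
by apply/andP; split; [apply: exprn_ge0|apply: exprn_ile1]; lra.
Qed.

Lemma step_poly_cvg1 y : 0 <= y < 2^-1 -> step_poly n y @[n --> \oo] --> (1 : R).
Proof.
move=> /andP[y0 y2]; have y01 : 0 <= y <= 1 by lra.
have c : 1 - (2 * y) ^+ n @[n --> \oo] --> (1 : R).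
  rewrite -[X in _ --> X]subr0; apply: cvgB; first exact: cvg_cst.
  by apply: cvg_expr; rewrite ger0_norm; lra.
apply: (squeeze_cvgr _ c (cvg_cst (1 : R))); near=> n.
have /andP[_ ->] := step_poly_itv n y01; rewrite andbT.
have := @bernoulli_ineq (- y ^+ n) (2 ^ n); rewrite mulrN natrX -exprMn; apply.
by rewrite lerN2 exprn_ile1//; lra.
Unshelve. all: by end_near. Qed.

Lemma step_poly_cvg0 y : 2^-1 < y <= 1 -> step_poly n y @[n --> \oo] --> (0 : R).
Proof.
move=> /andP[y2 y1]; have y0 : 0 < y by lra.
have c : ((2 * y)^-1) ^+ n @[n --> \oo] --> (0 : R).
  by apply: cvg_expr; rewrite ger0_norm ?invr_ge0 ?invf_lt1; lra.
apply: (squeeze_cvgr _ (cvg_cst 0) c); near=> n.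
have /andP[-> _] /= : 0 <= step_poly n y <= 1 by apply: step_poly_itv; lra.
rewrite exprVn -[leRHS]mul1r ler_pdivlMr; last by apply: exprn_gt0; lra.
rewrite mulrC exprMn -natrX; apply: expr_onem_le.
by rewrite exprn_ge0 ?exprn_ile1//; lra.
Unshelve. all: by end_near. Qed.

(* A real trigonometric polynomial of degree one, below [1/2] for [0 < t < x] and above
   for [x < t < 1]. *)
Definition arc (x t : R) : R := 2^-1 + sin (pi * t) * sin (pi * (t - x)) / 2.

Lemma arcE (x t : R) : arc x t = 2^-1 + (cos (pi * x) - cos (2 * pi * t - pi * x)) / 4.
Proof.
rewrite /arc (_ : pi * x = pi * t - pi * (t - x)); last by ring.
rewrite (_ : 2 * pi * t - _ = pi * t + pi * (t - x)); last by ring.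
by rewrite cosB cosD; field.
Qed.

Lemma arc_itv (x t : R) : 0 <= arc x t <= 1.
Proof.
rewrite arcE; have := cos_geN1 (pi * x); have := cos_le1 (pi * x).
have := cos_geN1 (2 * pi * t - pi * x); have := cos_le1 (2 * pi * t - pi * x).
by move=> *; apply/andP; split; lra.
Qed.

Lemma sin_pi_gt0 (s : R) : 0 < s < 1 -> 0 < sin (pi * s).
Proof.
move=> /andP[s0 s1]; have pi0 := pi_gt0 R.
by apply: sin_gt0_pi; rewrite mulr_gt0//= -[ltRHS]mulr1 ltr_pM2l.
Qed.

Lemma step_poly_arc_cvg (x t : R) : 0 < x < 1 -> 0 < t < 1 -> t <> x ->
  step_poly n (arc x t) @[n --> \oo] --> ((t <= x)%R%:R : R).
Proof.
move=> /andP[x0 x1] /andP[t0 t1] /eqP tx; have st : 0 < sin (pi * t).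
  by apply: sin_pi_gt0; rewrite t0.
have /andP[a0 a1] := arc_itv x t; have [tlex|xt] := leP t x.
  have sx : 0 < sin (pi * (x - t)).
    by apply: sin_pi_gt0; rewrite subr_gt0 lt_neqAle tx tlex /=; lra.
  by apply: step_poly_cvg1; rewrite a0 /= /arc -opprB mulrN sinN; nra.
have sx : 0 < sin (pi * (t - x)) by apply: sin_pi_gt0; lra.
by apply: step_poly_cvg0; rewrite a1 andbT /arc; nra.
Qed.

End StepPolynomials.

Section FourierUniqueness.
Variable R : realType.
Local Notation C := R[i].
Local Notation I := (@I01 R).
Implicit Types (f g w : R -> C).

Definition fourier_null f : Prop := L1_vanish_on setT f.

Definition preserves_null w : Prop :=
  forall g, fourier_null g -> fourier_null (fun t => w t * g t).

Lemma preserves_null_cst (c : C) : preserves_null (fun=> c).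
Proof. by move=> g; exact: L1_vanish_onZ. Qed.

Lemma preserves_null_zpow (n : int) : preserves_null (@zpow R n).
Proof.
move=> g [hg cg]; split=> [|k _]; first exact: L1_zpow.
by rewrite fourier_zpow cg.
Qed.

Lemma preserves_nullD v w : preserves_null v -> preserves_null w ->
  preserves_null (fun t => v t + w t).
Proof.
move=> hv hw g hg; apply: eq_fun_pred (L1_vanish_onD (hv _ hg) (hw _ hg)) => t.
by rewrite mulrDl.
Qed.

Lemma preserves_nullM v w : preserves_null v -> preserves_null w ->
  preserves_null (fun t => v t * w t).
Proof. by move=> hv hw g /hw/hv; apply: eq_fun_pred => t; rewrite mulrA. Qed.

Lemma preserves_nullX w n : preserves_null w -> preserves_null (fun t => w t ^+ n).
Proof.
move=> hw; elim: n => [|n ih]; first exact: (preserves_null_cst 1).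
by under eq_fun do rewrite exprS; exact: preserves_nullM.
Qed.

Lemma preserves_null_arc (x : R) : preserves_null (fun t => (arc x t)%:C).
Proof.
pose c0 : C := (2^-1 + cos (pi * x) / 4)%:C.
pose c1 : C := Complex (- cos (pi * x) / 8) (sin (pi * x) / 8).
rewrite (_ : (fun t => _) = (fun t => c0 + (c1 * zpow 1 t + conjc c1 * zpow (-1) t))).
  apply: preserves_nullD; first exact: preserves_null_cst.
  by apply: preserves_nullD; apply: preserves_nullM;
    by [exact: preserves_null_cst|exact: preserves_null_zpow].
have e1 t : 2 * pi * (1 : int)%:~R * t = 2 * pi * t :> R by rewrite mulr1z mulr1.
have eN t : 2 * pi * (-1 : int)%:~R * t = - (2 * pi * t) :> R.
  by rewrite mulrN1z mulrN1 mulNr.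
apply/funext => t; apply: eq_ReIm; rewrite /zpow e1 eN /= cosN sinN.
  by rewrite arcE cosB; field.
by field.
Qed.

Lemma preserves_null_step_poly (n : nat) (x : R) :
  preserves_null (fun t => (step_poly n (arc x t))%:C).
Proof.
rewrite (_ : (fun t => _) = (fun t => (1 + (-1) * (arc x t)%:C ^+ n) ^+ (2 ^ n))).
  apply: preserves_nullX; apply: preserves_nullD; first exact: preserves_null_cst.
  apply: preserves_nullM; first exact: preserves_null_cst.
  exact/preserves_nullX/preserves_null_arc.
by apply/funext => t; rewrite /step_poly mulN1r rmorphXn rmorphB rmorphXn.
Qed.

Lemma measurable_arc (x : R) : measurable_fun I (arc x).
Proof.
have msin (g : R -> R) : measurable_fun I g -> measurable_fun I (fun t => sin (g t)).
  apply: (measurableT_comp (f := @sin R)) => //.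
  exact: (continuous_measurable_fun (@continuous_sin R)).
have mid : measurable_fun I (fun t : R => t) by exact: measurable_id.
apply: measurable_funD; first exact: measurable_cst.
apply: measurable_funM; last exact: measurable_cst.
apply: measurable_funM; apply: msin; apply: measurable_funM => //;
  try exact: measurable_cst.
by apply: measurable_funB => //; exact: measurable_cst.
Qed.

Lemma measurable_le_indic (x : R) : measurable_fun I (fun t : R => (t <= x)%R%:R : R).
Proof.
rewrite (_ : (fun t => _) = (fun t => if t <= x then 1 else 0)).
  apply: measurable_fun_if; try exact: measurable_cst; first exact: measurable_I01.
  by apply: measurable_fun_ler => //; exact: measurable_cst.
by apply/funext => t; case: ifP.
Qed.

Lemma bounded_limit_step_poly_arc (x : R) : 0 < x < 1 ->
  bounded_limit (fun n t => (step_poly n (arc x t))%:C) (fun t => (t <= x)%R%:R%:C).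
Proof.
move=> x01; split.
- move=> n; apply: cmeasurable_real; apply: measurable_funX.
  apply: measurable_funB; first exact: measurable_cst.
  by apply: measurable_funX; exact: measurable_arc.
- by apply: cmeasurable_real; exact: measurable_le_indic.
- exists 1; apply: filterE => t n; rewrite cmod_real.
  by have /andP[s0 s1] := step_poly_itv n (arc_itv x t); rewrite ger0_norm.
have nt01 : ae01 (fun t : R => t <> 0 /\ t <> 1) by apply: filterI; exact: ae01_neq.
apply: filterS3 (ae01_neq x) (@ae01_in R) nt01 => t tx /andP[t0 t1] [/eqP nt0 /eqP nt1].
have t01 : 0 < t < 1 by rewrite !lt_neqAle eq_sym nt0 nt1 t0.
under eq_fun do rewrite -rmorphB cmod_real; apply/norm_cvg0P.
rewrite -(subrr ((t <= x)%R%:R)); apply: cvgB; last exact: cvg_cst.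
exact: step_poly_arc_cvg.
Qed.

Lemma fourier_null_le_indic f (x : R) : fourier_null f ->
  fourier_null (fun t => (t <= x)%R%:R%:C * f t).
Proof.
move=> hf; have [Lf _] := hf; have mf := L1_cmeasurable Lf.
have mxf : cmeasurable (fun t => (t <= x)%R%:R%:C * f t).
  by apply: cmeasurableM => //; apply: cmeasurable_real; exact: measurable_le_indic.
have [x0|x0] := leP x 0.
  apply: (L1_vanish_on_ae (L1_vanish_onZ 0 hf) mxf).
  apply: filterS2 (@ae01_in R) (ae01_neq x) => t /andP[t0 _] /eqP tx.
  by rewrite leNgt lt_neqAle eq_sym tx (le_trans x0 t0).
have [x1|x1] := leP 1 x.
  apply: (L1_vanish_on_ae hf mxf).
  by apply: filterS (@ae01_in R) => t /andP[_ t1]; rewrite (le_trans t1 x1) mul1r.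
have x01 : 0 < x < 1 by rewrite x0.
apply: (L1_vanish_on_bounded_limit (bounded_limit_step_poly_arc x01) Lf) => n.
exact: preserves_null_step_poly.
Qed.

Lemma fourier_null_Re f : fourier_null f -> fourier_null (fun t => (complex.Re (f t))%:C).
Proof.
move=> hf; have [Lf cf] := hf; under eq_fun do rewrite ReJ_add mulrC.
apply/L1_vanish_onZ/L1_vanish_onD => //.
by split=> [|k _]; [exact: L1_conjc|rewrite fourier_conjc// cf// conjc0].
Qed.

Lemma fourier_null_Re_eq0 f : fourier_null f -> ae01 (fun t => complex.Re (f t) = 0).
Proof.
move=> hf; pose g t : R := complex.Re (f t); have ig := integrable01_Re hf.1.
have ig1 : (@lebesgue_measure R).-integrable setT (EFin \o (g \_ I)).
  have [+ _] := @integrable_mkcond _ (measurableTypeR R) R (@lebesgue_measure R) I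
    (EFin \o g) (@measurable_I01_lebesgue R).
  by rewrite restrict_EFin; apply.
have igx x : (@lebesgue_measure R).-integrable `]-oo, x] (EFin \o (g \_ I)).
  by apply: integrableS ig1 => //; exact: measurable_itv.
have := FTC1Ny igx (integrable_locally (@measurable_I01 R) ig).
have -> : (fun x : R => \int[lebesgue_measure]_(t in `]-oo, x]) (g \_ I) t) = cst 0.
  apply/funext => x.
  have [_ /(_ 0 Logic.I)] := fourier_null_le_indic x (fourier_null_Re hf).
  rewrite fourier0; under eq_fun do rewrite -rmorphM.
  rewrite cmean_real => -[mx]; rewrite /= -mx /mean -Rintegral_mkcondr setIC.
  rewrite Rintegral_mkcondr; congr Rintegral; apply/funext => t.
  by rewrite /patch /= mem_setE in_itv /=; case: ifP; rewrite ?mul1r ?mul0r.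
apply: (filterS (F := almost_everywhere _)) => t [_]; rewrite derive1_cst => /esym h It.
by move: h; rewrite /patch mem_set.
Qed.

Theorem fourier_unique f : L1 f -> (forall k, fourier f k = 0) -> ae01 (fun t => f t = 0).
Proof.
move=> Lf cf; have nf : fourier_null f by split.
have nif := L1_vanish_onZ (Complex 0 (-1)) nf.
apply: filterS2 (fourier_null_Re_eq0 nf) (fourier_null_Re_eq0 nif) => t.
by rewrite Re_mulc /= mul0r sub0r mulN1r opprK => ? ?; exact: eq_ReIm.
Qed.

End FourierUniqueness.

Section LinearSubspace.
Variable R : realType.
Implicit Types (f g : R -> R[i]) (M : (R -> R[i]) -> Prop) (c : R[i]).

Definition linear_subspace M : Prop :=
  M (fun=> 0) /\ forall c f g, M f -> M g -> M (fun t => f t + c * g t).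

Lemma linear_subspaceZ M c f : linear_subspace M -> M f -> M (fun t => c * f t).
Proof.
by move=> [M0 Mlin] Mf; apply: eq_fun_pred (Mlin c _ _ M0 Mf) => t; rewrite add0r.
Qed.

Lemma linear_subspaceD M f g : linear_subspace M -> M f -> M g -> M (fun t => f t + g t).
Proof.
by move=> [_ Mlin] Mf Mg; apply: eq_fun_pred (Mlin 1 _ _ Mf Mg) => t; rewrite mul1r.
Qed.

Lemma linear_subspaceB M f g : linear_subspace M -> M f -> M g -> M (fun t => f t - g t).
Proof.
by move=> [_ Mlin] Mf Mg; apply: eq_fun_pred (Mlin (-1) _ _ Mf Mg) => t; rewrite mulN1r.
Qed.

End LinearSubspace.

Section WeightedL2.
Variable R : realType.
Local Notation C := R[i].
Local Notation I := (@I01 R).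
Implicit Types (f g F G p q : R -> C) (M : (R -> C) -> Prop).

Definition L2w (W : R -> R) f : Prop :=
  cmeasurable f /\ integrable01 (fun t => cmod (f t) ^+ 2 * W t).

Definition sqnorm (W : R -> R) f : R := mean (fun t => cmod (f t) ^+ 2 * W t).

Definition dotw (W : R -> R) f g : C :=
  cmean (fun t => conjc (g t) * f t * (W t)%:C).

Definition adherent (W : R -> R) M F : Prop :=
  L2w W F /\ forall e, 0 < e -> exists2 G, M G & sqnorm W (fun t => F t - G t) <= e.

Definition closed_subspace (W : R -> R) M : Prop :=
  [/\ forall p, M p -> L2w W p, linear_subspace M & forall F, adherent W M F -> M F].

Variable W : R -> R.
Hypotheses (W_ge1 : forall t, 1 <= W t) (mW : measurable_fun I W).

Let W_gt0 t : 0 < W t. Proof. exact: lt_le_trans (W_ge1 t). Qed.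

Lemma sqw_ge0 (z : C) t : 0 <= cmod z ^+ 2 * W t.
Proof. by rewrite mulr_ge0 ?sqr_ge0// ltW. Qed.

Lemma measurable_sqw f : cmeasurable f ->
  measurable_fun I (fun t => cmod (f t) ^+ 2 * W t).
Proof.
move=> mf; apply: measurable_funM => //.
by apply: measurable_funX; exact: measurable_cmod.
Qed.

Lemma sqnorm_ge0 f : 0 <= sqnorm W f.
Proof. by apply: mean_ge0 => t; exact: sqw_ge0. Qed.

Lemma L2w_le f k : cmeasurable f -> integrable01 k ->
  ae01 (fun t => cmod (f t) ^+ 2 * W t <= k t) -> L2w W f.
Proof.
move=> mf ik fk; split=> //; apply: (integrable01_le (measurable_sqw mf) ik).
by apply: filterS fk => t; rewrite ger0_norm ?sqw_ge0.
Qed.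

Lemma L2w_mul_unimodular f u : cmeasurable u -> (forall t, cmod (u t) = 1) ->
  L2w W f -> L2w W (fun t => u t * f t).
Proof.
move=> mu u1 [mf hf]; split; first exact: cmeasurableM.
by under eq_fun do rewrite cmodM u1 mul1r.
Qed.

Lemma sqnorm_mul_unimodular f u : (forall t, cmod (u t) = 1) ->
  sqnorm W (fun t => u t * f t) = sqnorm W f.
Proof. by move=> u1; congr mean; apply/funext => t; rewrite cmodM u1 mul1r. Qed.

Lemma L2wZ (c : C) f : L2w W f -> L2w W (fun t => c * f t).
Proof.
move=> [mf hf]; split; first exact: cmeasurableZ.
by under eq_fun do rewrite cmodM exprMn -mulrA; exact: integrable01Z.
Qed.

Lemma sqnormZ (c : C) f : L2w W f -> sqnorm W (fun t => c * f t) = cmod c ^+ 2 * sqnorm W f.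
Proof.
move=> [_ hf]; rewrite -meanZ//; congr mean; apply/funext => t.
by rewrite cmodM exprMn mulrA.
Qed.

Lemma L2wD f g : L2w W f -> L2w W g -> L2w W (fun t => f t + g t).
Proof.
move=> [mf hf] [mg hg].
have i2 := integrable01D (integrable01Z 2 hf) (integrable01Z 2 hg).
apply: (L2w_le (cmeasurableD mf mg) i2).
apply: filterE => t; apply: le_trans (ler_wpM2r (ltW (W_gt0 t)) (sqr_cmodD_le _ _)) _.
by rewrite mulrDl !mulrA.
Qed.

Lemma L2wB f g : L2w W f -> L2w W g -> L2w W (fun t => f t - g t).
Proof.
move=> hf /(L2wZ (-1)) hg; apply: eq_fun_pred (L2wD hf hg) => t.
by rewrite mulN1r.
Qed.

Lemma sqnorm_parallelogram f g : L2w W f -> L2w W g ->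
  sqnorm W (fun t => f t + g t) + sqnorm W (fun t => f t - g t) =
  2 * sqnorm W f + 2 * sqnorm W g.
Proof.
move=> hf hg; have [_ hfg] := L2wD hf hg; have [_ hfg'] := L2wB hf hg.
have [_ {}hf] := hf; have [_ {}hg] := hg.
rewrite /sqnorm -meanD// -!meanZ// -meanD; try exact: integrable01Z.
by congr mean; apply/funext => t; rewrite -mulrDl cmod_parallelogram mulrDl !mulrA.
Qed.

Lemma L1_dotw f g : L2w W f -> L2w W g -> L1 (fun t => conjc (g t) * f t * (W t)%:C).
Proof.
move=> [mf hf] [mg hg]; apply: (L1_le _ (integrable01Z 2^-1 (integrable01D hf hg))).
  by apply: cmeasurableM; [apply: cmeasurableM => //; exact: cmeasurable_conjc
                          |exact: cmeasurable_real].
apply: filterE => t; rewrite !cmodM cmod_conjc cmod_real gtr0_norm//.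
have : 0 <= W t * (cmod (f t) - cmod (g t)) ^+ 2 by rewrite mulr_ge0 ?sqr_ge0// ltW.
by move=> h; nra.
Qed.

Lemma sqnormDM f g (c : C) : L2w W f -> L2w W g ->
  sqnorm W (fun t => f t + c * g t) =
  sqnorm W f + 2 * complex.Re (conjc c * dotw W f g) + cmod c ^+ 2 * sqnorm W g.
Proof.
move=> hf hg; have hd := L1_dotw hf hg; have hr := integrable01_Re (L1Z (conjc c) hd).
have [_ {}hf] := hf; have [_ {}hg] := hg.
rewrite -cmeanZ//= /sqnorm -!meanZ// -!meanD//; try exact: integrable01Z; last first.
  by apply: integrable01D => //; exact: integrable01Z.
congr mean; apply/funext => t.
have -> : complex.Re (conjc c * (conjc (g t) * f t * (W t)%:C)) =
    complex.Re (conjc c * (conjc (g t) * f t)) * W t by rewrite -Re_mulcr -!mulrA.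
by rewrite sqr_cmodDM; ring.
Qed.

Section Duality.
Variables f g : R -> C.
Hypotheses (hf : L2w W f) (hg : L2w (fun t => (W t)^-1) g).

Lemma cmodM_le_weighted e t : 0 < e -> cmod (f t * g t) <=
  2^-1 * (e^-1 * (cmod (f t) ^+ 2 * W t) + e * (cmod (g t) ^+ 2 * (W t)^-1)).
Proof.
move=> e0; have w0 := W_gt0 t; rewrite cmodM.
set a := cmod (f t); set b := cmod (g t); set w := W t in w0 *.
have : 0 <= (a * w - e * b) ^+ 2 / (e * w).
  by rewrite divr_ge0 ?sqr_ge0// ltW// mulr_gt0.
have -> : (a * w - e * b) ^+ 2 / (e * w) =
    e^-1 * (a ^+ 2 * w) + e * (b ^+ 2 * w^-1) - 2 * (a * b).
  by field; rewrite !gt_eqF.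
by lra.
Qed.

Lemma L1_mul_L2w : L1 (fun t => f t * g t).
Proof.
have [mf hf'] := hf; have [mg hg'] := hg.
have h := integrable01D (integrable01Z 1^-1 hf') (integrable01Z 1 hg').
apply: (L1_le (cmeasurableM mf mg) (integrable01Z 2^-1 h)).
by apply: filterE => t; exact: cmodM_le_weighted.
Qed.

Lemma norm1_mul_L2w e : 0 < e -> norm1 (fun t => f t * g t) <=
  2^-1 * (e^-1 * sqnorm W f + e * sqnorm (fun t => (W t)^-1) g).
Proof.
move=> e0; have [_ hf'] := hf; have [_ hg'] := hg.
have h := integrable01D (integrable01Z e^-1 hf') (integrable01Z e hg').
rewrite /sqnorm -!meanZ// -meanD//; try exact: integrable01Z.
rewrite -meanZ//; apply: ler_mean; first exact/integrable01_cmod/L1_mul_L2w.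
  exact: integrable01Z.
by apply: filterE => t; exact: cmodM_le_weighted.
Qed.

End Duality.

Lemma sqnormV_ge0 g : 0 <= sqnorm (fun t => (W t)^-1) g.
Proof. by apply: mean_ge0 => t; rewrite mulr_ge0 ?sqr_ge0// invr_ge0 ltW. Qed.

Lemma L2wV_dominated g (c : R) : cmeasurable g -> integrable01 W ->
  ae01 (fun t => cmod (g t) <= c * W t) -> L2w (fun t => (W t)^-1) g.
Proof.
move=> mg iW gW; split=> //.
have mWV : measurable_fun I (fun t => (W t)^-1).
  by apply: measurable_invr_ge0 => // t; exact: ltW.
apply: (integrable01_le _ (integrable01Z (c ^+ 2) iW)).
  apply: measurable_funM => //; apply: measurable_funX; exact: measurable_cmod.
apply: filterS gW => t h; have w0 := W_gt0 t; have g0 := cmod_ge0 (g t).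
rewrite ger0_norm; last by rewrite divr_ge0 ?sqr_ge0// ltW.
rewrite ler_pdivrMr//.
by rewrite -mulrA -expr2 -exprMn lerXn2r// nnegrE// (le_trans g0).
Qed.

Lemma L2wV_cst (c : C) : L2w (fun t => (W t)^-1) (fun=> c).
Proof.
split; first exact: cmeasurable_cst.
have mWV : measurable_fun I (fun t => (W t)^-1).
  by apply: measurable_invr_ge0 => // t; exact: ltW.
apply: integrable01Z; apply: (integrable01_le mWV (integrable01_cst 1)).
by apply: filterE => t; rewrite gtr0_norm ?invr_gt0// invf_le1.
Qed.

Lemma sqnormV1_le : sqnorm (fun t => (W t)^-1) (fun=> 1) <= 1.
Proof.
rewrite -[leRHS](mean_cst (1 : R)); have [_ h] := L2wV_cst 1.
apply: ler_mean => //; first exact: integrable01_cst.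
by apply: filterE => t; rewrite cmod1 expr1n mul1r invf_le1.
Qed.

Lemma sqnorm_fatou (G : nat -> R -> C) F (c : R) : (forall n, L2w W (G n)) ->
  (forall n, sqnorm W (G n) <= c) -> cmeasurable F ->
  ae01 (fun t => cmod (G n t - F t) @[n --> \oo] --> (0 : R)) ->
  L2w W F /\ sqnorm W F <= c.
Proof.
move=> hG Gc mF GF.
have [|n t|//||t||] := @Rintegral_fatou _ _ R (@lebesgue_measure R) I
  (@measurable_I01_lebesgue R) (fun n t => cmod (G n t) ^+ 2 * W t)
  (fun t => cmod (F t) ^+ 2 * W t) c.
- by move=> n; case: (hG n).
- exact: sqw_ge0.
- exact: measurable_sqw.
- exact: sqw_ge0.
- apply: filterS GF => t /cvg_cmod GF.
  by apply: cvgM; [apply: cvgM|exact: cvg_cst].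
by move=> ? ?; split.
Qed.

Lemma fast_cauchy_ae_cvg (G : nat -> R -> C) : (forall n, L2w W (G n)) ->
  (forall n, sqnorm W (fun t => G n.+1 t - G n t) <= 4^-1 ^+ n) ->
  exists2 F, cmeasurable F & ae01 (fun t => cmod (G n t - F t) @[n --> \oo] --> (0 : R)).
Proof.
move=> hG Gn; pose d n t := cmod (G n.+1 t - G n t).
have hd n : L2w W (fun t => G n.+1 t - G n t) by exact: L2wB.
have dE n : d n = fun t => cmod ((G n.+1 t - G n t) * 1).
  by apply/funext => t; rewrite mulr1.
have id n : integrable01 (d n).
  by rewrite dE; exact/integrable01_cmod/(L1_mul_L2w (hd n))/L2wV_cst.
have mean_d n : mean (d n) <= 2^-1 ^+ n.
  have e0 : 0 < 2^-1 ^+ n :> R by rewrite exprn_gt0// invr_gt0.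
  rewrite dE; apply: le_trans (norm1_mul_L2w (hd n) (L2wV_cst 1) e0) _.
  have := Gn n; have := sqnormV1_le; set s := sqnorm _ _; set a := sqnorm _ _ => s1.
  rewrite (_ : 4^-1 = 2^-1 * 2^-1) ?exprMn; last by field.
  set e := 2^-1 ^+ n in e0 *; rewrite -ler_pdivrMl// => ae.
  have es : e * s <= e by rewrite ler_piMr// ltW.
  by lra.
have cvd : ae01 (fun t => cvgn (series (d ^~ t))).
  apply: (@ae01_cvg_series_geometric _ _ 1) => // [n t|n]; first exact: cmod_ge0.
  by rewrite mul1r; exact: mean_d.
have [n|n t|F1 mF1 cF1] := ae01_cvg_telescope _ cvd (f_ := fun n t => complex.Re (G n t)).
- by case: (hG n) => -[].
- by apply: le_trans (normr_Re_le _); rewrite raddfB.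
have [n|n t|F2 mF2 cF2] := ae01_cvg_telescope _ cvd (f_ := fun n t => complex.Im (G n t)).
- by case: (hG n) => -[].
- by apply: le_trans (normr_Im_le _); rewrite raddfB.
exists (fun t => Complex (F1 t) (F2 t)) => //.
by apply: filterS2 cF1 cF2 => t c1 c2; exact: (@cvg_ReIm _ (G ^~ t)).
Qed.

Lemma L2w_complete (G : nat -> R -> C) : (forall n, L2w W (G n)) ->
  (forall i j, (i <= j)%N -> sqnorm W (fun t => G j t - G i t) <= 4^-1 ^+ i) ->
  exists F, [/\ L2w W F, forall n, sqnorm W (fun t => F t - G n t) <= 4^-1 ^+ n
    & forall c N, (forall n, (N <= n)%N -> sqnorm W (G n) <= c) -> sqnorm W F <= c].
Proof.
move=> hG Gij; have [n|F mF GF] := fast_cauchy_ae_cvg hG; first exact: Gij.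
have fatou (H : R -> C) N c : L2w W H ->
    (forall n, sqnorm W (fun t => G (N + n)%N t - H t) <= c) ->
    L2w W (fun t => F t - H t) /\ sqnorm W (fun t => F t - H t) <= c.
  move=> hH hc; apply: (sqnorm_fatou _ hc) => [n||]; first exact: L2wB.
    by apply: cmeasurableB => //; case: hH.
  apply: filterS GF => t /(cvg_shift_addl N).
  by under [in X in _ -> X]eq_fun do rewrite opprB addrA subrK.
have h0 : L2w W (fun=> 0) by apply: eq_fun_pred (L2wZ 0 (hG 0%N)) => t; rewrite mul0r.
have FG n := fatou (G n) n _ (hG n) (fun k => Gij n (n + k)%N (leq_addr k n)).
exists F; split.
- by apply: eq_fun_pred (L2wD (FG 0%N).1 (hG 0%N)) => t; rewrite subrK.
- by move=> n; have [] := FG n.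
move=> c N hc; have [n|_] := fatou (fun=> 0) N c h0.
  by under eq_fun do rewrite subr0; apply: hc; exact: leq_addr.
by under eq_fun do rewrite subr0.
Qed.

Lemma dotw_eq0_of_min F g : L2w W F -> L2w W g ->
  (forall c : C, sqnorm W F <= sqnorm W (fun t => F t + c * g t)) -> dotw W F g = 0.
Proof.
move=> hF hg hmin; set a := dotw W F g; have g0 := sqnorm_ge0 g.
pose s : R := (1 + sqnorm W g)^-1; have s0 : 0 < s by rewrite invr_gt0; lra.
have := hmin (- (s%:C * a)).
have E : complex.Re (conjc (- (s%:C * a)) * a) = - (s * cmod a ^+ 2).
  by rewrite sqr_cmod; case: (a) => x y /=; ring.
rewrite sqnormDM// -/a E -addrA lerDl cmodN cmodM cmod_real exprMn.
rewrite real_normK ?num_real//.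
have -> : 2 * - (s * cmod a ^+ 2) + s ^+ 2 * cmod a ^+ 2 * sqnorm W g =
   s * cmod a ^+ 2 * (s * sqnorm W g - 2) by ring.
have sg : s * sqnorm W g - 2 < 0 by rewrite subr_lt0 /s ltr_pdivrMl; lra.
have [/eqP a0 _|a0] := eqVneq (cmod a) 0; first by apply: cmod0_eq0; exact/eqP.
have sa : 0 < s * cmod a ^+ 2 by rewrite mulr_gt0// exprn_even_gt0.
by rewrite pmulr_rge0// leNgt sg.
Qed.

Section Projection.
Variable M : (R -> C) -> Prop.
Hypothesis closedM : closed_subspace W M.

Lemma closed_subspace_ae p q : M p -> cmeasurable q -> ae01 (fun t => p t = q t) -> M q.
Proof.
have [ML _ Mcl] := closedM; move=> Mp mq pq; have [mp hp] := ML _ Mp.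
apply: Mcl; split.
  by apply: (L2w_le mq hp); apply: filterS pq => t ->.
move=> e e0; exists p => //; rewrite /sqnorm (@ae_eq_mean _ _ (fun=> 0)) ?mean_cst ?ltW//.
- by apply: measurable_sqw; exact: cmeasurableB.
by apply: filterS pq => t ->; rewrite subrr cmod0 expr0n mul0r.
Qed.

Lemma minimizing_sequence q : L2w W q -> exists (m : R) (G : nat -> R -> C),
  [/\ forall p, M p -> m <= sqnorm W (fun t => q t - p t), forall n, M (G n)
    & forall n, sqnorm W (fun t => q t - G n t) <= m + 4^-1 ^+ n / 4].
Proof.
have [_ [M0 _] _] := closedM; move=> hq.
pose A := [set sqnorm W (fun t => q t - p t) | p in M].
have infA : has_inf A.
  split; first by exists (sqnorm W (fun t => q t - 0)), (fun=> 0).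
  by exists 0 => _ [p _ <-]; exact: sqnorm_ge0.
have /choice[G hG] : forall n, exists G, M G /\
    sqnorm W (fun t => q t - G t) <= inf A + 4^-1 ^+ n / 4.
  move=> n; have dn : 0 < 4^-1 ^+ n / 4 :> R by rewrite divr_gt0// exprn_gt0// invr_gt0.
  by have [_ [G MG <-] h] := inf_adherent dn infA; exists G; split => //; exact: ltW.
exists (inf A), G; split=> [p Mp|n|n]; [|by case: (hG n)|by case: (hG n)].
by apply: ge_inf; [exact: infA.2|exists p].
Qed.

(* Parallelogram law: nearly minimal distances force a sequence to be Cauchy. *)
Lemma minimizing_cauchy q (m d : R) p p' : L2w W q ->
  (forall p, M p -> m <= sqnorm W (fun t => q t - p t)) -> M p -> M p' ->
  sqnorm W (fun t => q t - p t) <= m + d -> sqnorm W (fun t => q t - p' t) <= m + d ->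
  sqnorm W (fun t => (q t - p t) - (q t - p' t)) <= 4 * d.
Proof.
have [ML lM _] := closedM; have [_ Mlin] := lM; move=> hq hm Mp Mp' dp dp'.
have hp := L2wB hq (ML _ Mp); have hp' := L2wB hq (ML _ Mp').
have := sqnorm_parallelogram hp hp'.
have := hm _ (Mlin 2^-1 _ _ (linear_subspaceZ 2^-1 lM Mp) Mp').
rewrite (_ : (fun t => _ - _) = (fun t => 2^-1 * (q t - p t + (q t - p' t)))); last first.
  by apply/funext => t; field.
rewrite sqnormZ; last exact: L2wD.
rewrite -realC2V cmod_real ger0_norm ?invr_ge0// (_ : 2^-1 ^+ 2 = 4^-1 :> R); last by field.
by move=> *; lra.
Qed.

Theorem L2w_projection q : L2w W q ->
  exists F, [/\ M (fun t => q t - F t), sqnorm W F <= sqnorm W q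
    & forall p, M p -> dotw W F p = 0].
Proof.
have [ML [M0 Mlin] Mcl] := closedM; move=> hq.
have [m [G [hm MG mG]]] := minimizing_sequence hq.
have hG n : L2w W (fun t => q t - G n t) by exact/(L2wB hq)/ML.
have dle i j : (i <= j)%N -> 4^-1 ^+ j / 4 <= 4^-1 ^+ i / 4 :> R.
  by move=> ij; rewrite ler_wpM2r ?invr_ge0//; apply: ler_wiXn2l => //; by [|lra].
have cG i j : (i <= j)%N ->
    sqnorm W (fun t => (q t - G j t) - (q t - G i t)) <= 4^-1 ^+ i.
  move=> ij; rewrite -[leRHS](@divfK _ 4) ?pnatr_eq0// mulrC.
  apply: (minimizing_cauchy hq hm) => //; apply: le_trans (mG j) _.
  by rewrite lerD2l dle.
have [F [hF FG Fle]] := L2w_complete hG cG.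
have cvd : 4^-1 ^+ n @[n --> \oo] --> (0 : R).
  by apply: cvg_expr; rewrite ger0_norm ?invr_ge0// invf_lt1// ltr1n.
have small e : 0 < e -> exists N, forall n, (N <= n)%N -> 4^-1 ^+ n <= e :> R.
  move=> e0; have /cvgr0Pnorm_le/(_ e e0)[N _ hN] := cvd.
  by exists N => n Nn; apply: le_trans (ler_norm _) (hN n Nn).
have MF : M (fun t => q t - F t).
  apply: Mcl; split=> [|e e0]; first exact: L2wB.
  have [N /(_ N (leqnn N)) hN] := small e e0; exists (G N) => //.
  rewrite (_ : (fun t => _) = (fun t => (-1) * (F t - (q t - G N t)))); last first.
    by apply/funext => t; ring.
  rewrite sqnormZ; last exact: L2wB.
  by rewrite cmodN cmod1 expr1n mul1r (le_trans (FG N)).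
have Fm : sqnorm W F <= m.
  apply/ler_addgt0Pl => e e0; rewrite addrC.
  have [N hN] := small (e * 4) (mulr_gt0 e0 (ltr0Sn _ 3)).
  apply: (Fle _ N) => n Nn; apply: le_trans (mG n) _; rewrite lerD2l ler_pdivrMr//.
  exact: hN.
exists F; split=> //.
  by apply: le_trans Fm (le_trans (hm _ M0) _); under eq_fun do rewrite subr0.
move=> p Mp; apply: dotw_eq0_of_min => // [|c]; first exact: ML.
apply: le_trans Fm _; have := hm _ (Mlin (- c) _ _ MF Mp).
by rewrite (_ : (fun t => _ - _) = (fun t => F t + c * p t))//; apply/funext => t; ring.
Qed.

End Projection.

End WeightedL2.

Section HardySpace.
Variable R : realType.
Local Notation C := R[i].
Local Notation I := (@I01 R).
Implicit Types (f g u : R -> C).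

Lemma H1_L1 f : H1 f -> L1 f. Proof. by case. Qed.

Lemma H1_cmeasurable f : H1 f -> cmeasurable f. Proof. by case=> /L1_cmeasurable. Qed.

Lemma H1P f : H1 f <-> L1 f /\ forall n : nat, cmean (fun t => zpow n.+1 t * f t) = 0.
Proof.
split=> -[Lf cf]; split=> //.
  by move=> n; have := cf (Negz n) isT; rewrite fourierE NegzE opprK.
by case=> // n _; rewrite fourierE NegzE opprK.
Qed.

Lemma H1D f g : H1 f -> H1 g -> H1 (fun t => f t + g t).
Proof. exact: (@L1_vanish_onD _ [set k | (k < 0)%R]). Qed.

Lemma H1Z (c : C) f : H1 f -> H1 (fun t => c * f t).
Proof. exact: (@L1_vanish_onZ _ [set k | (k < 0)%R]). Qed.

Lemma H1B f g : H1 f -> H1 g -> H1 (fun t => f t - g t).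
Proof.
by move=> hf /(H1Z (-1)) hg; apply: eq_fun_pred (H1D hf hg) => t; rewrite mulN1r.
Qed.

Lemma H1_ae f g : H1 f -> cmeasurable g -> ae01 (fun t => f t = g t) -> H1 g.
Proof. exact: (@L1_vanish_on_ae _ [set k | (k < 0)%R]). Qed.

Lemma H1_closed f : L1 f ->
  (forall e, 0 < e -> exists2 g, H1 g & norm1 (fun t => f t - g t) <= e) -> H1 f.
Proof. exact: (@L1_vanish_on_closed _ [set k | (k < 0)%R]). Qed.

Lemma H1_bounded_limit (w_ : nat -> R -> C) w g : bounded_limit w_ w -> L1 g ->
  (forall n, H1 (fun t => w_ n t * g t)) -> H1 (fun t => w t * g t).
Proof. exact: (@L1_vanish_on_bounded_limit _ [set k | (k < 0)%R]). Qed.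

Lemma H1_zpow f (n : nat) : H1 f -> H1 (fun t => zpow n t * f t).
Proof.
move=> [Lf cf]; split=> [|k k0]; first exact: L1_zpow.
by rewrite fourier_zpow cf// (le_lt_trans _ k0)// lerBlDr lerDl.
Qed.

Lemma H1_cst (c : C) : H1 (fun _ : R => c).
Proof.
apply/H1P; split=> [|n]; first exact: L1_cst.
under eq_fun do rewrite mulrC; rewrite cmeanZ ?cmean_zpow ?mulr0//.
apply: (@L1_bounded _ _ 1); first exact: cmeasurable_zpow.
by apply: filterE => t; rewrite cmod_zpow.
Qed.

Lemma H1_real_cst (k : R -> R) : integrable01 k -> H1 (fun t => (k t)%:C) ->
  ae01 (fun t => k t = mean k).
Proof.
move=> ik hk; pose g t := k t - mean k.
have ig : integrable01 g by apply: integrable01B => //; exact: integrable01_cst.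
have [Lg cg] : H1 (fun t => (g t)%:C).
  by apply: eq_fun_pred (H1B hk (H1_cst (mean k)%:C)) => t; rewrite /g rmorphB.
have g0 : fourier (fun t => (g t)%:C) 0 = 0.
  rewrite fourier0 cmean_real meanB ?mean_cst ?subrr//; exact: integrable01_cst.
have /filterS : ae01 (fun t => (g t)%:C = 0 :> C).
  apply: fourier_unique => // j; have [/cg//|j0|->//] := ltgtP j 0.
  under [X in fourier X]eq_fun do rewrite -conjc_real.
  by rewrite fourier_conjc// cg ?conjc0// oppr_lt0.
by apply => t -[] /subr0_eq.
Qed.

Lemma sqw_cst_of_shift_orthogonal (W : R -> R) F : L2w W F ->
  (forall n : nat, dotw W F (fun t => zpow n.+1 t * F t) = 0) ->
  ae01 (fun t => cmod (F t) ^+ 2 * W t = sqnorm W F).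
Proof.
move=> [mF iF] orth; apply: H1_real_cst => //.
apply/H1P; split=> [|n]; first exact: L1_real.
have Lk := L1_real iF; rewrite -[LHS]conjcK -cmean_conjc; last exact: L1_zpow.
rewrite -[RHS]conjc0 -(orth n); congr conjc; congr cmean; apply/funext => t.
rewrite !conjcM conjc_real -mulrA -mulrA; congr (_ * _).
by rewrite rmorphM /= -mulc_conjc; ring.
Qed.

Definition shift_invariant (M : (R -> C) -> Prop) : Prop :=
  forall p, M p -> M (fun t => zpow 1 t * p t).

Lemma shift_invariant_zpow M p (n : nat) : shift_invariant M -> M p ->
  M (fun t => zpow n t * p t).
Proof.
move=> Mz Mp; elim: n => [|n ih]; first by under eq_fun do rewrite zpow0 mul1r.
by apply: eq_fun_pred (Mz _ ih) => t; rewrite mulrA -zpowD.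
Qed.

Section WanderingVector.
Variables (W : R -> R) (M : (R -> C) -> Prop).
Hypotheses (W_ge1 : forall t, 1 <= W t) (mW : measurable_fun I W).
Hypotheses (closedM : closed_subspace W M) (Mz : shift_invariant M).

Lemma closed_subspace_shift : closed_subspace W (fun p => M (fun t => zpow (-1) t * p t)).
Proof.
have [ML [M0 Mlin] Mcl] := closedM.
have mz n := cmeasurable_zpow R n; have z1 n t := cmod_zpow n t : cmod (zpow n t : C) = 1.
split=> [p /ML hp||F [hF Fe]].
- by apply: eq_fun_pred (L2w_mul_unimodular (mz 1) (z1 1) hp) => t; exact: zpowNK.
- split=> [|c p q Mp Mq]; first by under eq_fun do rewrite mulr0.
  by apply: eq_fun_pred (Mlin c _ _ Mp Mq) => t; ring.
apply: Mcl; split; first exact: L2w_mul_unimodular.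
move=> e /Fe[G MG FG]; exists (fun t => zpow (-1) t * G t) => //.
by under eq_fun do rewrite -mulrBr; rewrite sqnorm_mul_unimodular.
Qed.

(* The projection of [q] onto the orthogonal complement of [z M]. *)
Lemma wandering_vector q : M q -> exists J,
  [/\ M J, M (fun t => zpow (-1) t * (q t - J t)), sqnorm W J <= sqnorm W q,
      forall p (n : nat), M p -> dotw W J (fun t => zpow n.+1 t * p t) = 0
    & ae01 (fun t => cmod (J t) ^+ 2 * W t = sqnorm W J)].
Proof.
move=> Mq; have [ML [_ Mlin] _] := closedM.
have [J [MqJ Jq Jorth]] := L2w_projection W_ge1 mW closed_subspace_shift (ML _ Mq).
have MJ : M J.
  apply: eq_fun_pred (Mlin (-1) _ _ Mq (Mz MqJ)) => t.
  by rewrite zpowNK; ring.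
have Jorthz p (n : nat) : M p -> dotw W J (fun t => zpow n.+1 t * p t) = 0.
  move=> Mp; apply: Jorth; apply: eq_fun_pred (shift_invariant_zpow n Mz Mp) => t.
  by rewrite -add1n PoszD zpowD -mulrA zpowK.
exists J; split=> //; apply: sqw_cst_of_shift_orthogonal; first exact: ML.
by move=> n; exact: Jorthz.
Qed.

End WanderingVector.

Definition H1_multiplier (W : R -> R) (Gamma : (R -> C) -> Prop) p : Prop :=
  L2w W p /\ forall g, Gamma g -> H1 (fun t => p t * g t).

Section Multipliers.
Variables (W : R -> R) (Gamma : (R -> C) -> Prop).
Hypotheses (W_ge1 : forall t, 1 <= W t) (mW : measurable_fun I W).
Hypothesis Gamma_L2wV : forall g, Gamma g -> L2w (fun t => (W t)^-1) g.

Lemma closed_subspace_H1_multiplier : closed_subspace W (H1_multiplier W Gamma).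
Proof.
have L20 : L2w W (fun=> 0).
  apply: (L2w_le W_ge1 mW (cmeasurable_cst 0) (integrable01_cst 0)).
  by apply: filterE => t; rewrite cmod0 expr0n mul0r.
split=> [p []//||F [hF Fe]].
- split; first by split=> // g _; under eq_fun do rewrite mul0r; exact: H1_cst.
  move=> c p q [hp pG] [hq qG]; split=> [|g Gg]; first by apply: L2wD => //; exact: L2wZ.
  by apply: eq_fun_pred (H1D (pG _ Gg) (H1Z c (qG _ Gg))) => t; rewrite mulrDl mulrA.
split=> // g Gg; have hg := Gamma_L2wV Gg.
apply: H1_closed => [|e e0]; first exact: (L1_mul_L2w W_ge1 hF hg).
set b := sqnorm (fun t => (W t)^-1) g; have b0 : 0 <= b := sqnormV_ge0 W_ge1 g.
pose d := 2 * e / (1 + b); have d0 : 0 < d by rewrite divr_gt0 ?mulr_gt0//; lra.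
have [G [hG GG] FG] := Fe (d ^+ 2) (exprn_gt0 2 d0).
exists (fun t => G t * g t); first exact: GG.
under eq_fun do rewrite -mulrBl.
apply: le_trans (norm1_mul_L2w W_ge1 (L2wB W_ge1 mW hF hG) hg d0) _.
rewrite -/b (_ : e = 2^-1 * (d + d * b)); last by rewrite /d; field; lra.
rewrite ler_wpM2l ?invr_ge0// lerD2r -[leRHS](_ : d^-1 * d ^+ 2 = d).
  by rewrite ler_wpM2l ?invr_ge0// ltW.
by field; rewrite gt_eqF.
Qed.

Lemma shift_invariant_H1_multiplier : shift_invariant (H1_multiplier W Gamma).
Proof.
move=> p [hp pG]; split.
  apply: L2w_mul_unimodular => //; first exact: cmeasurable_zpow.
  by move=> t; exact: cmod_zpow.
by move=> g /pG /(H1_zpow 1); apply: eq_fun_pred => t; rewrite mulrA.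
Qed.

End Multipliers.

Lemma mean_sqr_cmodB1 f : L1 f -> integrable01 (fun t => cmod (f t) ^+ 2) -> cmean f = 1 ->
  integrable01 (fun t => cmod (f t - 1) ^+ 2) /\
  mean (fun t => cmod (f t - 1) ^+ 2) = mean (fun t => cmod (f t) ^+ 2) - 1.
Proof.
move=> Lf if2 f1; have iR := integrable01Z 2 (integrable01_Re Lf).
have iB := integrable01B if2 iR; have i1 : integrable01 (fun=> 1 : R) := integrable01_cst 1.
have -> : (fun t => cmod (f t - 1) ^+ 2) =
    (fun t => cmod (f t) ^+ 2 - 2 * complex.Re (f t) + 1).
  by apply/funext => t; rewrite !sqr_cmod !raddfB /=; ring.
split; first exact: integrable01D.
rewrite meanD// meanB// meanZ; last exact: integrable01_Re.
by move: f1 => [-> _]; rewrite mean_cst; ring.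
Qed.

(* Szego's extremal problem: the wandering vector of the constant [1] in the space of
   multipliers of the dominated [H1] functions. *)
Lemma szego_multiplier W : (forall t, 1 <= W t) -> integrable01 W ->
  exists F, [/\ cmeasurable F, ae01 (fun t => cmod (F t) ^+ 2 * W t <= mean W),
    integrable01 (fun t => cmod (F t - 1) ^+ 2),
    mean (fun t => cmod (F t - 1) ^+ 2) <= mean W - 1
  & forall g (c : R), H1 g -> ae01 (fun t => cmod (g t) <= c * W t) ->
      H1 (fun t => F t * g t)].
Proof.
move=> W_ge1 iW; have mW := integrable01_measurable iW.
pose Gamma g := H1 g /\ exists c : R, ae01 (fun t => cmod (g t) <= c * W t).
have Gamma1 : Gamma (fun=> 1).
  by split; [exact: H1_cst|exists 1; apply: filterE => t; rewrite cmod1 mul1r].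
have Gamma_L2 g : Gamma g -> L2w (fun t => (W t)^-1) g.
  by move=> [hg [c gW]]; exact: L2wV_dominated (H1_cmeasurable hg) iW gW.
have M1 : H1_multiplier W Gamma (fun=> 1).
  split=> [|g [hg _]]; last by under eq_fun do rewrite mul1r.
  apply: (L2w_le W_ge1 mW (cmeasurable_cst 1) iW).
  by apply: filterE => t; rewrite cmod1 expr1n mul1r.
have [F [[[mF iFW] FG] [_ qG] F1W _ Fcst]] := wandering_vector W_ge1 mW
  (closed_subspace_H1_multiplier W_ge1 mW Gamma_L2)
  (shift_invariant_H1_multiplier (Gamma := Gamma)) M1.
have FW : sqnorm W F <= mean W.
  by apply: le_trans F1W _; rewrite /sqnorm; under eq_fun do rewrite cmod1 expr1n mul1r.
have HF : H1 F by apply: eq_fun_pred (FG _ Gamma1) => t; rewrite mulr1.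
have F1 : cmean F = 1.
  have /H1P[_ /(_ 0%N)] := qG _ Gamma1.
  under eq_fun do rewrite mulr1 zpowNK.
  rewrite cmeanB ?cmean_cst; [|exact: L1_cst|exact: H1_L1].
  by move=> /subr0_eq.
have leW t : cmod (F t) ^+ 2 <= cmod (F t) ^+ 2 * W t by rewrite ler_peMr// sqr_ge0.
have iF2 : integrable01 (fun t => cmod (F t) ^+ 2).
  apply: (integrable01_le _ iFW); first by apply: measurable_funX; exact: measurable_cmod.
  by apply: filterE => t; rewrite ger0_norm ?sqr_ge0.
have [iF1 F1E] := mean_sqr_cmodB1 (H1_L1 HF) iF2 F1.
exists F; split=> //.
- by apply: filterS Fcst => t ->.
- by rewrite F1E lerD2r (le_trans _ FW)// ler_mean//; exact: filterE.
by move=> g c hg gW; apply: FG; split=> //; exists c.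
Qed.

Lemma ae01_cvg0_sqr (w_ : nat -> R -> C) (c : R) :
  (forall n, integrable01 (fun t => cmod (w_ n t) ^+ 2)) ->
  (forall n, mean (fun t => cmod (w_ n t) ^+ 2) <= c * 2^-1 ^+ n) ->
  ae01 (fun t => cmod (w_ n t) @[n --> \oo] --> (0 : R)).
Proof.
move=> iw wc; have := ae01_cvg_series_geometric iw (fun n t => sqr_ge0 _) wc.
apply: filterS => t /cvg_series_cvg_0 w0.
have := cvg_comp _ _ w0 (@sqrt_continuous R 0); rewrite sqrtr0.
rewrite (_ : _ \o _ = (fun n => cmod (w_ n t)))//.
by apply/funext => n /=; rewrite sqrtr_sqr ger0_norm// cmod_ge0.
Qed.

Local Notation one := (fun _ : R => 1 : R).

Let one_ge1 t : 1 <= one t. Proof. exact: lexx. Qed.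

Let measurable_one : measurable_fun I one. Proof. exact: measurable_cst. Qed.

Lemma L2w_oneV f : L2w one f -> L2w (fun t => (one t)^-1) f.
Proof. by under [in X in _ -> X]eq_fun do rewrite invr1. Qed.

Lemma L2w_one_bounded f (M : R) : cmeasurable f -> ae01 (fun t => cmod (f t) <= M) ->
  L2w one f.
Proof.
move=> mf fM.
apply: (L2w_le one_ge1 measurable_one mf (integrable01_cst (M ^+ 2))).
apply: filterS fM => t h; have f0 := cmod_ge0 (f t).
by rewrite mulr1 lerXn2r// nnegrE// (le_trans f0).
Qed.

Lemma H1_approximate_unit u : L1 u -> exists F : nat -> R -> C,
  [/\ bounded_limit F (fun=> 1), forall n, L2w one (fun t => F n t * u t)
    & forall n g, H1 g -> (forall t, cmod (g t) <= cmod (u t)) ->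
        H1 (fun t => F n t * g t)].
Proof.
move=> Lu; pose K := norm1 u; have K0 : 0 <= K := norm1_ge0 u.
pose ep n : R := 2^-1 ^+ n; have ep0 n : 0 < ep n by rewrite exprn_gt0// invr_gt0.
have ep1 n : ep n <= 1 by rewrite exprn_ile1// ?invr_ge0// invf_le1// ler1n.
pose W n t := 1 + ep n * cmod (u t).
have W_ge1 n t : 1 <= W n t by rewrite lerDl mulr_ge0 ?cmod_ge0// ltW.
have iu := integrable01_cmod Lu; have ieu n := integrable01Z (ep n) iu.
have iW n : integrable01 (W n) by apply: integrable01D => //; exact: integrable01_cst.
have WE n : mean (W n) = 1 + ep n * K.
  by rewrite meanD ?mean_cst ?meanZ//; exact: integrable01_cst.
have /choice[F hF] := fun n => szego_multiplier (W_ge1 n) (iW n).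
have mF n : cmeasurable (F n) by case: (hF n).
have FK n : ae01 (fun t => cmod (F n t) ^+ 2 * W n t <= 1 + K).
  have [_ FW _ _ _] := hF n; apply: filterS FW => t /le_trans; apply.
  by rewrite WE lerD2l ler_piMl.
exists F; split=> [|n|n g hg gu].
- split=> //.
    exists (1 + K); apply: filterS (ae01_forall FK) => t FKt n.
    have := FKt n; have := W_ge1 n t; have := cmod_ge0 (F n t).
    set a := cmod _; set w := W n t => a0 w1 aw; rewrite leNgt; apply/negP => aK.
    have : a ^+ 2 <= a ^+ 2 * w by rewrite ler_peMr// sqr_ge0.
    by nra.
  apply: (@ae01_cvg0_sqr (fun n t => F n t - 1) K) => n; first by case: (hF n).
  by have [_ _ _ + _] := hF n; rewrite WE addrC addKr mulrC.
- apply: (L2w_le one_ge1 measurable_one (cmeasurableM (mF n) (L1_cmeasurable Lu))).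
    exact: (integrable01Z ((1 + K) / ep n) iu).
  apply: filterS (FK n) => t FKt; have u0 := cmod_ge0 (u t); have e0 := ep0 n.
  rewrite mulr1 cmodM exprMn [leRHS]mulrAC ler_pdivlMr//.
  apply: le_trans (ler_wpM2r u0 FKt); rewrite /W.
  set a := cmod (F n t) ^+ 2; set b := cmod (u t) in u0 *.
  by have : 0 <= a * b by [rewrite mulr_ge0// sqr_ge0|]; nra.
have [_ _ _ _ /(_ g (ep n)^-1 hg)] := hF n; apply; apply: filterE => t.
rewrite mulrDr mulr1 mulKf ?gt_eqF//; apply: le_trans (gu t) _.
by rewrite lerDr invr_ge0 ltW.
Qed.

Definition H2 f : Prop := H1 f /\ L2w one f.

Lemma H2_zpow (n : nat) : H2 (@zpow R n).
Proof.
split; first by apply: eq_fun_pred (H1_zpow n (H1_cst 1)) => t; rewrite mulr1.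
apply: (@L2w_one_bounded _ 1); first exact: cmeasurable_zpow.
by apply: filterE => t; rewrite cmod_zpow.
Qed.

(* The multipliers of [H2] contain the monomials; a function of [H2] orthogonal to all of
   those vanishes. *)
Lemma H2M f g : H2 f -> H2 g -> H1 (fun t => f t * g t).
Proof.
move=> [hf Lf] h2g.
have H2V g' : H2 g' -> L2w (fun t => (one t)^-1) g' by move=> [_ /L2w_oneV].
have [e [[_ feH2] _ orth]] := L2w_projection one_ge1 measurable_one
  (closed_subspace_H1_multiplier one_ge1 measurable_one H2V) Lf.
have he : H1 e.
  apply: eq_fun_pred (H1B hf (feH2 _ (H2_zpow 0))) => t.
  by rewrite zpow0 mulr1 opprB addrC subrK.
have e0 : ae01 (fun t => e t = 0).
  apply: fourier_unique => [|[n|n]]; first exact: H1_L1; last by case: he => _; apply.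
  rewrite fourierE -(orth (@zpow R n)).
    by congr cmean; apply/funext => t; rewrite rmorph1 mulr1 conjc_zpow.
  by split=> [|g' [hg' _]]; [case: (H2_zpow n)|exact: H1_zpow].
apply: (H1_ae (feH2 _ h2g)).
  by apply: cmeasurableM; [exact: H1_cmeasurable hf|case: h2g => /H1_cmeasurable].
by apply: filterS e0 => t ->; rewrite subr0.
Qed.

Lemma H1_mul_bounded f u (M : R) : H1 f -> ae01 (fun t => cmod (f t) <= M) -> H1 u ->
  H1 (fun t => f t * u t).
Proof.
move=> hf fM hu; have mf := H1_cmeasurable hf; have Lu := H1_L1 hu.
have [F [F1 FL2 FH1]] := H1_approximate_unit Lu.
have Lfu : L1 (fun t => f t * u t) := L1_mul_bounded mf fM Lu.
apply: eq_fun_pred (H1_bounded_limit F1 Lfu _) => [t|n]; first by rewrite mul1r.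
apply: eq_fun_pred (H2M (f := f) (g := fun t => F n t * u t) _ _) => [t||].
- by rewrite mulrCA.
- by split=> //; exact: L2w_one_bounded fM.
- by split=> //; exact: FH1.
Qed.


Implicit Types (p q : R -> C) (M : (R -> C) -> Prop).

Lemma backward_shift_defect M p : (forall p, M p -> H1 p) -> M p ->
  ~ ae01 (fun t => p t = 0) -> exists2 q, M q & ~ M (fun t => zpow (-1) t * q t).
Proof.
move=> MH Mp pn0; apply: contrapT => defect; apply: pn0.
have Mback (n : nat) : M (fun t => zpow (- (n : int)) t * p t).
  elim: n => [|n ih]; first by under eq_fun do rewrite oppr0 zpow0 mul1r.
  apply: contrapT => h; apply: defect; exists (fun t => zpow (- (n : int)) t * p t) => //.
  by apply: contra_not h; apply: eq_fun_pred => t; rewrite mulrA -zpowD -opprD -PoszD.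
apply: fourier_unique => [|k]; first exact/H1_L1/MH.
case: k => [n|n]; last by have [_] := MH _ Mp; apply.
have [_ /(_ (-1) isT)] := MH _ (Mback n.+1); rewrite fourier_zpow => <-.
by congr fourier; rewrite opprK -addn1 PoszD addrC addrK.
Qed.

Lemma beurling M p0 : closed_subspace one M -> shift_invariant M ->
  (forall p, M p -> H1 p) -> M p0 -> ~ ae01 (fun t => p0 t = 0) ->
  exists J, [/\ M J, ae01 (fun t => cmod (J t) = 1)
    & forall p, M p -> H1 (fun t => conjc (J t) * p t)].
Proof.
move=> clM Mz MH Mp0 p0n; have [ML lM _] := clM.
have [q Mq nMq] := backward_shift_defect MH Mp0 p0n.
have [J [MJ MqJ _ orth Jc]] :=
  wandering_vector one_ge1 measurable_one clM Mz Mq.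
set c := sqnorm _ J in Jc; have LJ := ML _ MJ; have mq := H1_cmeasurable (MH _ Mq).
have c0 : 0 < c.
  rewrite lt_neqAle (sqnorm_ge0 one_ge1) andbT; apply/eqP => c0; apply: nMq.
  apply: (closed_subspace_ae one_ge1 measurable_one clM MqJ).
    by apply: cmeasurableM => //; exact: cmeasurable_zpow.
  apply: filterS Jc => t; rewrite -c0 mulr1 => /eqP.
  by rewrite sqrf_eq0 => /eqP/cmod0_eq0 ->; rewrite subr0.
have HJ p : M p -> H1 (fun t => conjc (J t) * p t).
  move=> Mp; have LJp : L1 (fun t => conjc (J t) * p t).
    by apply: eq_fun_pred (L1_dotw one_ge1 measurable_one (ML _ Mp) LJ) => t;
      rewrite mulr1.
  apply/H1P; split=> // n; rewrite -[LHS]conjcK -cmean_conjc; last exact: L1_zpow.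
  rewrite -[RHS]conjc0 -(orth _ n Mp); congr conjc; congr cmean; apply/funext => t.
  by rewrite !conjcM conjcK mulr1; ring.
pose s : R := (Num.sqrt c)^-1; have s0 : 0 < s by rewrite invr_gt0 sqrtr_gt0.
exists (fun t => s%:C * J t); split.
- exact: linear_subspaceZ.
- apply: filterS Jc => t; rewrite mulr1 => Jt; rewrite cmodM cmod_real gtr0_norm//.
  have -> : cmod (J t) = Num.sqrt c by rewrite -Jt sqrtr_sqr ger0_norm// cmod_ge0.
  by rewrite mulVf// gt_eqF// sqrtr_gt0.
by move=> p /HJ/(H1Z s%:C); apply: eq_fun_pred => t; rewrite conjcM conjc_real mulrA.
Qed.

Section InnerDenominator.
Variable r : R -> R.
Hypotheses (mr : measurable_fun I r) (r1 : forall t, `|r t| <= 1).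

Let denominators p : Prop :=
  H1_multiplier one (fun g => g = (fun=> 1) \/ g = (fun t => (r t)%:C)) p.

Let denominatorsP p : denominators p <->
  [/\ L2w one p, H1 p & H1 (fun t => (r t)%:C * p t)].
Proof.
split=> [[hp pG]|[hp p1 pr]]; split=> //.
- by apply: eq_fun_pred (pG _ (or_introl erefl)) => t; rewrite mulr1.
- by apply: eq_fun_pred (pG _ (or_intror erefl)) => t; rewrite mulrC.
move=> g [->|->]; first by under eq_fun do rewrite mulr1.
by under eq_fun do rewrite mulrC.
Qed.

Let closed_denominators : closed_subspace one denominators.
Proof.
apply: closed_subspace_H1_multiplier one_ge1 measurable_one _.
move=> g Gg; apply/L2w_oneV; case: Gg => ->.
  by apply: (L2w_one_bounded (cmeasurable_cst 1)); exact: filterE.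
apply: (@L2w_one_bounded _ 1); first exact: cmeasurable_real.
by apply: filterE => t; rewrite cmod_real.
Qed.

Let denominators_approx u : H1 u -> H1 (fun t => (r t)%:C * u t) ->
  exists2 F : nat -> R -> C, bounded_limit F (fun=> 1)
    & forall n, denominators (fun t => F n t * u t).
Proof.
move=> hu hru; have [F [F1 FL2 FH1]] := H1_approximate_unit (H1_L1 hu).
exists F => // n; apply/denominatorsP; split=> //; first exact: FH1.
apply: eq_fun_pred (FH1 n _ hru _) => t; first by rewrite mulrCA.
by rewrite cmodM cmod_real ler_piMl ?cmod_ge0.
Qed.

Lemma inner_denominator u0 : (forall c, ~ ae01 (fun t => r t = c)) ->
  H1 u0 -> H1 (fun t => (r t)%:C * u0 t) -> ~ ae01 (fun t => u0 t = 0) ->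
  exists J, [/\ inner J, nonconstant J &
    forall u, H1 u -> H1 (fun t => (r t)%:C * u t) -> H1 (fun t => u t / J t)].
Proof.
move=> rn hu0 hru0 u0n; have MH p : denominators p -> H1 p by move=> /denominatorsP[].
have [F F1 FM] := denominators_approx hu0 hru0.
have [n Fn0] : exists n, ~ ae01 (fun t => F n t * u0 t = 0).
  apply: contrapT => h; apply: u0n; have Lu0 := H1_L1 hu0.
  apply: norm1_small => // e e0; have [n Fe] := bounded_limit_approx F1 Lu0 e0.
  apply: le_trans Fe; rewrite le_eqVlt; apply/orP; left; apply/eqP.
  have Fn0 : ae01 (fun t => F n t * u0 t = 0).
    by apply: contrapT => Fn0; apply: h; exists n.
  apply: ae_eq_norm1; first exact: L1_cmeasurable.
    apply: cmeasurableB; first by apply: cmeasurableZ; exact: L1_cmeasurable.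
    exact/H1_cmeasurable/MH.
  by apply: filterS Fn0 => t ->; rewrite subr0 mul1r.
have [J [/denominatorsP[LJ hJ hrJ] J1 JM]] := beurling closed_denominators
  (@shift_invariant_H1_multiplier one _) MH (FM n) Fn0.
have mJ := H1_cmeasurable hJ; have mcJ := cmeasurable_conjc mJ.
have cJ1 : ae01 (fun t => cmod (conjc (J t)) <= 1).
  by apply: filterS J1 => t; rewrite cmod_conjc => ->.
exists J; split.
- split=> //; split; last by case: hJ.
  by split=> //; exists 1; apply: filterS J1 => t ->.
- move=> [c Jc]; apply: (rn (mean r)); apply: H1_real_cst.
    by apply: (integrable01_le mr (integrable01_cst 1)); exact: filterE.
  apply: (H1_ae (H1Z (conjc c) hrJ)); first exact: cmeasurable_real.
  by apply: filterS2 Jc J1 => t <- h; rewrite mulrCA conjc_mul_unimodular ?mulr1.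
move=> u hu hru; have Lu := H1_L1 hu.
have [G G1 GM] := denominators_approx hu hru.
have hJu : H1 (fun t => 1 * (conjc (J t) * u t)).
  apply: (H1_bounded_limit G1); first exact: L1_mul_bounded cJ1 Lu.
  by move=> m; apply: eq_fun_pred (JM _ (GM m)) => t; rewrite mulrCA.
apply: (H1_ae hJu).
  by apply: cmeasurableM; [exact: L1_cmeasurable|exact: cmeasurableV].
by apply: filterS J1 => t h; rewrite mul1r invc_unimodular// mulrC.
Qed.

End InnerDenominator.

End HardySpace.

Section Peaking.
Variable R : realType.
Local Notation C := R[i].
Local Notation I := (@I01 R).
Implicit Types (q x J : R -> C).

Lemma bounded_limit_onem (w_ : nat -> R -> C) w : bounded_limit w_ w ->
  bounded_limit (fun n t => 1 - w_ n t) (fun t => 1 - w t).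
Proof.
move=> [mw_ mw [M w_M] w_w]; split.
- by move=> n; apply: cmeasurableB => //; exact: cmeasurable_cst.
- by apply: cmeasurableB => //; exact: cmeasurable_cst.
- exists (1 + M); apply: filterS w_M => t w_M n; apply: le_trans (ler_cmodB _ _) _.
  by rewrite cmod1 lerD2l.
apply: filterS w_w => t.
by under [in X in _ -> X]eq_fun do rewrite cmodBC opprB addrC addrA subrK.
Qed.

Lemma bounded_limit_expr q : cmeasurable q ->
  ae01 (fun t => cmod (q t) < 1 \/ q t = 1) ->
  bounded_limit (fun n t => q t ^+ n) (fun t => (q t == 1)%:R%:C).
Proof.
move=> mq q1; split.
- by move=> n; exact: cmeasurableX.
- apply: cmeasurable_real.
  rewrite (_ : (fun t => _) = (fun t => if cmod (q t - 1) == 0 then 1 else 0)).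
    apply: measurable_fun_if; try exact: measurable_cst; first exact: measurable_I01.
    apply: measurable_fun_eqr; last exact: measurable_cst.
    by apply: measurable_cmod; apply: cmeasurableB => //; exact: cmeasurable_cst.
  apply/funext => t; have [->|qt1] := eqVneq (q t) 1; first by rewrite subrr cmod0 eqxx.
  by case: eqP => // /cmod0_eq0/subr0_eq/eqP; rewrite (negbTE qt1).
- exists 1; apply: filterS q1 => t [qt1|->] n; last by rewrite expr1n cmod1.
  by rewrite cmodX exprn_ile1 ?cmod_ge0// ltW.
apply: filterS q1 => t [qt1|->]; last first.
  under eq_fun do rewrite expr1n eqxx subrr cmod0.
  exact: cvg_cst.
rewrite (_ : (q t == 1) = false); last first.
  by apply/eqP => qt; move: qt1; rewrite qt cmod1 ltxx.
under eq_fun do rewrite subr0 cmodX.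
by apply: cvg_expr; rewrite ger0_norm ?cmod_ge0.
Qed.

(* [(1 - q ^ n) x] is the sum of the [q ^ k ((1 - q) x)] with [k < n]. *)
Lemma H1_div_1B q x : H1 q -> ae01 (fun t => cmod (q t) < 1) -> L1 x ->
  H1 (fun t => (1 - q t) * x t) -> H1 x.
Proof.
move=> hq q1 Lx hqx; have mq := H1_cmeasurable hq.
have q1' : ae01 (fun t => cmod (q t) <= 1) by apply: filterS q1 => t /ltW.
have qpeak : ae01 (fun t => cmod (q t) < 1 \/ q t = 1) by apply: filterS q1; left.
apply: (H1_ae (H1_bounded_limit (bounded_limit_onem (bounded_limit_expr mq qpeak)) Lx _)).
- elim=> [|n ih]; first by under eq_fun do rewrite expr0 subrr mul0r; exact: H1_cst.
  apply: eq_fun_pred (H1D hqx (H1_mul_bounded hq q1' ih)) => t.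
  by rewrite exprS; ring.
- exact: L1_cmeasurable.
apply: filterS q1 => t qt1; rewrite (_ : (q t == 1) = false) ?subr0 ?mul1r//.
by apply/eqP => qt; move: qt1; rewrite qt cmod1 ltxx.
Qed.

Lemma H1_peak_cst q : H1 q -> ae01 (fun t => cmod (q t) < 1 \/ q t = 1) ->
  ae01 (fun t => q t = 1) \/ ae01 (fun t => q t <> 1).
Proof.
move=> hq qpeak; have mq := H1_cmeasurable hq.
have q1 : ae01 (fun t => cmod (q t) <= 1).
  by apply: filterS qpeak => t [/ltW//|->]; rewrite cmod1.
have blim := bounded_limit_expr mq qpeak.
have hX n : H1 (fun t => q t ^+ n * 1).
  elim: n => [|n ih]; first by under eq_fun do rewrite mulr1; exact: H1_cst.
  by apply: eq_fun_pred (H1_mul_bounded hq q1 ih) => t; rewrite exprS mulrA.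
have hind : H1 (fun t => (q t == 1)%:R%:C).
  by apply: eq_fun_pred (H1_bounded_limit blim (L1_cst 1) hX) => t; rewrite mulr1.
have icst := H1_real_cst (integrable01_Re (H1_L1 hind)) hind.
set c := mean _ in icst; have [c1|c1] := eqVneq c 1; [left|right].
  apply: filterS icst => t /=; rewrite c1.
  by case: eqP => // _ /eqP; rewrite eq_sym oner_eq0.
by apply: filterS icst => t /= + qt1; rewrite qt1 eqxx => c1'; move: c1; rewrite -c1' eqxx.
Qed.

Lemma inner_H1 J : inner J -> H1 J.
Proof.
move=> [[[mJ _] cJ] J1]; split=> //; apply: (@L1_bounded _ _ 1) => //.
by apply: filterS J1 => t ->.
Qed.

Lemma inner_cmod_le1 J : inner J -> ae01 (fun t => cmod (J t) <= 1).
Proof. by move=> [_ J1]; apply: filterS J1 => t ->. Qed.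

Lemma inner_ae_neq J (c : C) : inner J -> nonconstant J -> ae01 (fun t => J t <> c).
Proof.
move=> iJ nJ; have hJ := inner_H1 iJ; have [_ J1] := iJ.
have [c1|c1] := eqVneq (cmod c) 1; last first.
  by apply: filterS J1 => t Jt Jc; move: c1; rewrite -Jc Jt eqxx.
have cJ t : conjc c * J t = 1 -> J t = c.
  by move=> h; rewrite -[LHS]mul1r -(conjc_mul_unimodular c1) -mulrA mulrCA h mulr1.
pose q t := (1 + conjc c * J t) / 2.
have q1 t : q t = 1 -> J t = c.
  move=> qt; apply: cJ; apply: (addrI 1).
  have := congr1 (fun w => w * 2) qt; rewrite /q divfK ?pnatr_eq0// => ->.
  by rewrite mul1r.
have [|//||] := @H1_peak_cst q.
- apply: eq_fun_pred (H1Z 2^-1 (H1D (H1_cst 1) (H1Z (conjc c) hJ))) => t.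
  by rewrite mulrC.
- apply: filterS J1 => t Jt; have [|//|w1] := @half_1D_unimodular _ (conjc c * J t).
  + by rewrite cmodM cmod_conjc c1 Jt mulr1.
  + by left.
  by right; rewrite /q w1 -[1 + 1]/(2%:R) divff ?pnatr_eq0.
- by move=> qc; case: nJ; exists c; apply: filterS qc => t; exact: q1.
apply: filterS => t qn Jc; apply: qn.
by rewrite /q Jc conjc_mul_unimodular// divff ?pnatr_eq0.
Qed.

Lemma H1_div_1D_unimodular J x : H1 J -> ae01 (fun t => cmod (J t) = 1) ->
  ae01 (fun t => J t <> -1) -> L1 x -> H1 (fun t => (1 + J t) * x t) -> H1 x.
Proof.
move=> hJ J1 Jn1 Lx hx; apply: (@H1_div_1B (fun t => (1 + - J t) / 2)) => //.
- apply: eq_fun_pred (H1Z 2^-1 (H1B (H1_cst 1) hJ)) => t; by rewrite mulrC.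
- apply: filterS2 J1 Jn1 => t Jt Jn; have [|//|JN] := @half_1D_unimodular _ (- J t).
    by rewrite cmodN.
  by case: Jn; rewrite -JN opprK.
by apply: eq_fun_pred (H1Z 2^-1 hx) => t; field.
Qed.

End Peaking.

Section MidpointEquality.
Variable R : realType.
Local Notation C := R[i].
Local Notation I := (@I01 R).
Implicit Types (g h : R -> C) (s : R -> R).

Lemma norm1_half_sum_eq g1 g2 h : L1 g1 -> L1 g2 -> L1 h ->
  ae01 (fun t => h t = (g1 t + g2 t) / 2) ->
  norm1 g1 <= norm1 h -> norm1 g2 <= norm1 h ->
  [/\ norm1 g1 = norm1 h, norm1 g2 = norm1 h
    & ae01 (fun t => cmod (g1 t + g2 t) = cmod (g1 t) + cmod (g2 t))].
Proof.
move=> L1g1 L1g2 L1h hE n1 n2; have L12 := L1D L1g1 L1g2.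
have n12 : norm1 (fun t => g1 t + g2 t) = 2 * norm1 h.
  rewrite -(ger0_norm (ler0n R 2)) -cmod_real rmorph_nat -norm1Z//.
  apply: ae_eq_norm1; try exact: L1_cmeasurable; first exact/L1_cmeasurable/L1Z.
  by apply: filterS hE => t ->; rewrite mulrC divfK ?pnatr_eq0.
have := norm1D L1g1 L1g2; rewrite n12 => n12le.
have [e1 e2] : norm1 g1 = norm1 h /\ norm1 g2 = norm1 h by split; lra.
pose k t := cmod (g1 t) + cmod (g2 t) - cmod (g1 t + g2 t).
have i12 := integrable01D (integrable01_cmod L1g1) (integrable01_cmod L1g2).
have ik : integrable01 k by apply: integrable01B => //; exact: integrable01_cmod.
have mk0 : mean k = 0.
  rewrite meanB//; last exact: integrable01_cmod.
  rewrite meanD; try exact: integrable01_cmod.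
  by rewrite -!norm1E e1 e2 n12; ring.
have k0 t : 0 <= k t by rewrite subr_ge0 ler_cmodD.
by split=> //; apply: filterS (mean_eq0 ik k0 mk0) => t /subr0_eq.
Qed.

Definition modulus_ratio g1 g2 (t : R) : R :=
  (cmod (g1 t) - cmod (g2 t)) / (cmod (g1 t) + cmod (g2 t)).

Lemma measurable_modulus_ratio g1 g2 : cmeasurable g1 -> cmeasurable g2 ->
  measurable_fun I (modulus_ratio g1 g2).
Proof.
move=> /measurable_cmod m1 /measurable_cmod m2.
apply: measurable_funM; first exact: measurable_funB.
apply: measurable_invr_ge0; first exact: measurable_funD.
by move=> t; rewrite addr_ge0 ?cmod_ge0.
Qed.

Lemma normr_modulus_ratio_le1 g1 g2 t : `|modulus_ratio g1 g2 t| <= 1.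
Proof.
have a0 := cmod_ge0 (g1 t); have b0 := cmod_ge0 (g2 t).
rewrite /modulus_ratio; set a := cmod _ in a0 *; set b := cmod _ in b0 *.
have [ab0|ab0] := eqVneq (a + b) 0; first by rewrite ab0 invr0 mulr0 normr0.
have ab : 0 < a + b by rewrite lt_neqAle eq_sym ab0 addr_ge0.
rewrite normrM normfV [`|a + b|]gtr0_norm// ler_pdivrMr// mul1r ler_norml.
by apply/andP; split; lra.
Qed.

Lemma modulus_ratioE g1 g2 t :
  modulus_ratio g1 g2 t * (cmod (g1 t) + cmod (g2 t)) = cmod (g1 t) - cmod (g2 t).
Proof.
have a0 := cmod_ge0 (g1 t); have b0 := cmod_ge0 (g2 t).
rewrite /modulus_ratio; have [ab0|ab0] := eqVneq (cmod (g1 t) + cmod (g2 t)) 0.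
  by rewrite ab0 mulr0; lra.
by rewrite divfK.
Qed.

Lemma modulus_ratio_cst g1 g2 (c : R) : L1 g1 -> L1 g2 -> norm1 g1 = norm1 g2 ->
  ae01 (fun t => modulus_ratio g1 g2 t = c) -> c = 0 \/ norm1 g1 = 0.
Proof.
move=> /integrable01_cmod i1 /integrable01_cmod i2 n12 rc.
have i12 := integrable01D i1 i2.
have : mean (fun t => cmod (g1 t) - cmod (g2 t)) =
    mean (fun t => c * (cmod (g1 t) + cmod (g2 t))).
  apply: ae_eq_mean.
  - by apply: integrable01_measurable; exact: integrable01B.
  - by apply: integrable01_measurable; exact: integrable01Z.
  by apply: filterS rc => t <-; rewrite modulus_ratioE.
rewrite meanB// meanZ// meanD// -!norm1E n12 subrr => /esym/eqP.
rewrite -mulr2n mulf_eq0 mulrn_eq0 /= => /orP[/eqP|/eqP]; by [left|right].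
Qed.

Lemma norm1_mul_1D (s : R -> R) h : measurable_fun I s ->
  ae01 (fun t => `|s t| <= 1) -> L1 h ->
  mean (fun t => s t * cmod (h t)) = 0 ->
  norm1 (fun t => h t + (s t)%:C * h t) = norm1 h.
Proof.
move=> ms s1 Lh sh0; have ih := integrable01_cmod Lh; have mh := L1_cmeasurable Lh.
have ish := integrable01_mul_bounded ms s1 ih.
rewrite -[norm1 h]addr0 -sh0 norm1E -meanD//; apply: ae_eq_mean.
- apply: measurable_cmod; apply: cmeasurableD => //.
  by apply: cmeasurableM => //; exact: cmeasurable_real.
- by apply: integrable01_measurable; exact: integrable01D.
apply: filterS s1 => t; rewrite ler_norml => /andP[st _].
have -> : h t + (s t)%:C * h t = (1 + s t)%:C * h t.
  by rewrite rmorphD rmorph1 mulrDl mul1r.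
by rewrite cmodM cmod_real ger0_norm ?mulrDl ?mul1r//; lra.
Qed.

End MidpointEquality.

Section ToeplitzKernel.
Variable R : realType.
Local Notation C := R[i].
Local Notation I := (@I01 R).
Implicit Types (f g h u phi psi J : R -> C) (s : R -> R) (b : C).

Definition toeplitz_dual phi f : R -> C := fun t => conjc (zid t * phi t * f t).

Lemma toeplitz_dual_real phi f s :
  toeplitz_dual phi (fun t => (s t)%:C * f t) =1
  (fun t => (s t)%:C * toeplitz_dual phi f t).
Proof. by move=> t; rewrite /toeplitz_dual mulrCA [LHS]conjcM conjc_real. Qed.

Lemma K1_mul_real phi f s : H1 (fun t => (s t)%:C * f t) ->
  H1 (fun t => (s t)%:C * toeplitz_dual phi f t) -> K1 phi (fun t => (s t)%:C * f t).
Proof.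
move=> hsf hsdf; split=> //; apply: eq_fun_pred hsdf => t.
exact/esym/toeplitz_dual_real.
Qed.

Lemma K1_L1 phi f : K1 phi f -> L1 f. Proof. by move=> [/H1_L1]. Qed.

Lemma linear_subspace_K1 phi : linear_subspace (K1 phi).
Proof.
split; first by split; [|under eq_fun do rewrite mulr0 conjc0]; exact: H1_cst.
move=> c f g [hf df] [hg dg]; split; first by apply: H1D => //; exact: H1Z.
apply: eq_fun_pred (H1D df (H1Z (conjc c) dg)) => t.
by rewrite -conjcM -rmorphD /=; congr conjc; ring.
Qed.

Lemma linear_subspace_Espace phi psi : linear_subspace (Espace phi psi).
Proof.
have [K0 Klin] := linear_subspace_K1 phi; split.
  split=> //; exists (fun=> 0); split; first exact: H1_cst.
  by apply: filterE => t; rewrite mulr0.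
move=> c f g [kf [f' [hf' fE]]] [kg [g' [hg' gE]]]; split; first exact: Klin.
exists (fun t => f' t + c * g' t); split; first by apply: H1D => //; exact: H1Z.
by apply: filterS2 fE gE => t -> ->; ring.
Qed.

Lemma Espace_null phi psi f : K1 phi f -> ae01 (fun t => f t = 0) -> Espace phi psi f.
Proof.
move=> kf f0; split=> //; exists (fun=> 0); split; first exact: H1_cst.
by apply: filterS f0 => t ->; rewrite mulr0.
Qed.

Lemma rel_prime_half_sum phi g1 g2 h : K1 phi g1 -> K1 phi g2 -> K1 phi h ->
  ae01 (fun t => h t = (g1 t + g2 t) / 2) ->
  norm1 g1 <= norm1 h -> norm1 g2 <= norm1 h ->
  rel_prime_inner h (toeplitz_dual phi h) -> ae01 (fun t => g1 t = g2 t).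
Proof.
move=> kg1 kg2 kh hE n1 n2 rp; have [hh hdh] := kh.
have L1g1 := K1_L1 kg1; have L1g2 := K1_L1 kg2; have L1h := K1_L1 kh.
have [e1 e2 aligned] := norm1_half_sum_eq L1g1 L1g2 L1h hE n1 n2.
have [nh0|nh0] := eqVneq (norm1 h) 0.
  have g10 := norm1_eq0 L1g1 (etrans e1 nh0); have g20 := norm1_eq0 L1g2 (etrans e2 nh0).
  by apply: filterS2 g10 g20 => t -> ->.
have hn0 : ~ ae01 (fun t => h t = 0).
  move=> h0; move/eqP: nh0; apply; rewrite -(cmod0 R) -norm1_cst.
  by apply: ae_eq_norm1; [exact: L1_cmeasurable|exact: cmeasurable_cst|];
    apply: filterS h0 => t ->.
pose r := modulus_ratio g1 g2; pose d t := (g1 t - g2 t) / 2.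
have mr : measurable_fun I r by apply: measurable_modulus_ratio; exact: L1_cmeasurable.
have dr : ae01 (fun t => d t = (r t)%:C * h t).
  by apply: filterS2 aligned hE => t /cmodD_eq al ->; rewrite /d al mulrA.
have [hd hdd] : K1 phi d.
  apply: eq_fun_pred (linear_subspaceZ 2^-1 (linear_subspace_K1 phi)
    (linear_subspaceB (linear_subspace_K1 phi) kg1 kg2)) => t.
  by rewrite mulrC.
have hrh : H1 (fun t => (r t)%:C * h t).
  apply: (H1_ae hd) => //; apply: cmeasurableM; first exact: cmeasurable_real.
  exact: L1_cmeasurable.
have hrdh : H1 (fun t => (r t)%:C * toeplitz_dual phi h t).
  apply: (H1_ae hdd); first apply: cmeasurableM; first exact: cmeasurable_real.
    exact: H1_cmeasurable hdh.
  by apply: filterS dr => t ->; rewrite -toeplitz_dual_real.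
apply: contrapT => g12; have rn (c : R) : ~ ae01 (fun t => r t = c).
  move=> rc; have [c0|/eqP] := modulus_ratio_cst L1g1 L1g2 (etrans e1 (esym e2)) rc.
    apply: g12; apply: filterS2 dr rc => t dt rt; move: dt.
    rewrite rt c0 mul0r => /eqP; rewrite mulf_eq0 invr_eq0 pnatr_eq0 orbF subr_eq0.
    by move=> /eqP.
  by rewrite e1 (negbTE nh0).
have [J [iJ nJ Jdiv]] :=
  inner_denominator mr (normr_modulus_ratio_le1 g1 g2) rn hh hrh hn0.
by apply: rp; exists J; exact: (conj iJ (conj nJ (conj (Jdiv _ hh hrh) (Jdiv _ hdh hrdh)))).
Qed.

Lemma H1_mul_Re_inner J b u : inner J -> H1 u -> H1 (fun t => u t / J t) ->
  H1 (fun t => (complex.Re (b * J t))%:C * u t).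
Proof.
move=> iJ hu huJ; have hJ := inner_H1 iJ; have [_ J1] := iJ.
apply: (H1_ae (H1D (H1Z (b / 2) (H1_mul_bounded hJ (inner_cmod_le1 iJ) hu))
  (H1Z (conjc b / 2) huJ))).
  apply: cmeasurableM; last exact: H1_cmeasurable.
  by apply: cmeasurable_real; case: (cmeasurableZ b (H1_cmeasurable hJ)).
by apply: filterS J1 => t Jt; rewrite (invc_unimodular Jt) ReJ_add conjcM; field.
Qed.

Lemma inner_sqr_ae_neqN1 J b : inner J -> nonconstant J -> cmod b = 1 ->
  ae01 (fun t => b ^+ 2 * (J t * J t) <> -1).
Proof.
move=> iJ nJ b1; have bb := conjc_mul_unimodular b1.
apply: filterS2 (inner_ae_neq ('i%C * conjc b) iJ nJ)
  (inner_ae_neq (- 'i%C * conjc b) iJ nJ) => t n1 n2 JN.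
have wE : J t = b * J t * conjc b by rewrite mulrC mulrA bb mul1r.
have : (b * J t) ^+ 2 == 'i%C ^+ 2 by rewrite sqr_i -JN exprMn expr2 -expr2.
by rewrite eqf_sqr => /orP[]/eqP w; [apply: n1|apply: n2]; rewrite wE w.
Qed.

(* On the circle [2 b J Re (b J) = 1 + b ^ 2 J ^ 2], which is outer. *)
Lemma mulH1_of_mul_Re_inner psi J b h : inner psi -> inner J -> nonconstant J ->
  cmod b = 1 -> L1 h -> mulH1 psi (fun t => (complex.Re (b * J t))%:C * h t) ->
  mulH1 psi h.
Proof.
move=> ipsi iJ nJ b1 Lh [g [hg gE]]; have hJ := inner_H1 iJ; have [_ J1] := iJ.
have J1' := inner_cmod_le1 iJ; have [_ psi1] := ipsi; have mJ := H1_cmeasurable hJ.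
have mw : cmeasurable (fun t => conjc (psi t) / J t).
  apply: cmeasurableM; last exact: cmeasurableV.
  exact/cmeasurable_conjc/H1_cmeasurable/inner_H1.
pose x t := conjc (psi t) / J t * h t.
have Lx : L1 x.
  apply: (L1_mul_bounded (M := 1) mw) => //.
  by apply: filterS2 psi1 J1 => t pt Jt; rewrite cmodM cmodV cmod_conjc pt Jt invr1 mulr1.
have hJ2 : H1 (fun t => b ^+ 2 * (J t * J t)) by apply/H1Z/(H1_mul_bounded hJ J1').
have hx : H1 x.
  apply: (H1_div_1D_unimodular hJ2) => //.
  - by apply: filterS J1 => t Jt; rewrite !cmodM b1 Jt !mulr1.
  - exact: inner_sqr_ae_neqN1.
  apply: (H1_ae (H1Z (2 * b) hg)).
    apply: cmeasurableM; last exact: L1_cmeasurable.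
    by apply: cmeasurableD; [exact: cmeasurable_cst|exact: H1_cmeasurable].
  apply: filterS3 gE psi1 J1 => t gt pt Jt.
  have -> : g t = conjc (psi t) * ((complex.Re (b * J t))%:C * h t).
    by rewrite gt mulrA conjc_mul_unimodular ?mul1r.
  rewrite ReJ_add conjcM -(invc_unimodular Jt) /x; have J0 := unimodular_neq0 Jt.
  transitivity (conjc (psi t) * (b ^+ 2 * J t + (conjc b * b) / J t) * h t); first by field.
  by rewrite conjc_mul_unimodular//; field.
exists (fun t => J t * x t); split; first exact: (H1_mul_bounded hJ J1' hx).
apply: filterS2 psi1 J1 => t pt Jt; have J0 := unimodular_neq0 Jt; rewrite /x.
have -> : psi t * (J t * (conjc (psi t) / J t * h t)) =
  (conjc (psi t) * psi t) * h t by field.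
by rewrite conjc_mul_unimodular ?mul1r.
Qed.

Lemma common_divisor_perturbation phi h J : K1 phi h -> inner J -> nonconstant J ->
  H1 (fun t => h t / J t) -> H1 (fun t => toeplitz_dual phi h t / J t) ->
  exists p, [/\ K1 phi p, norm1 (fun t => h t + p t) = norm1 h,
    norm1 (fun t => h t - p t) = norm1 h
  & forall psi, inner psi -> mulH1 psi p -> mulH1 psi h].
Proof.
move=> [hh hdh] iJ nJ hhJ hdhJ; have mJ := H1_cmeasurable (inner_H1 iJ).
have Lh := H1_L1 hh; have Lch := L1_real (integrable01_cmod Lh).
have [b b1 bJ] := rotate_to_imaginary (cmean (fun t => J t * (cmod (h t))%:C)).
pose s t := complex.Re (b * J t).
have ms : measurable_fun I s by case: (cmeasurableZ b mJ).
have s1 : ae01 (fun t => `|s t| <= 1).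
  apply: filterS (inner_cmod_le1 iJ) => t Jt.
  by apply: le_trans (normr_Re_le _) _; rewrite cmodM b1 mul1r.
have sh0 : mean (fun t => s t * cmod (h t)) = 0.
  rewrite -bJ -cmeanZ; last exact: L1_mul_bounded (inner_cmod_le1 iJ) Lch.
  by congr mean; apply/funext => t; rewrite mulrA Re_mulcr.
exists (fun t => (s t)%:C * h t); split.
- by apply: K1_mul_real; exact: H1_mul_Re_inner.
- exact: norm1_mul_1D.
- have ih := integrable01_cmod Lh.
  rewrite -(@norm1_mul_1D _ (fun t => - s t) h)//.
  + by congr norm1; apply/funext => t; rewrite rmorphN mulNr.
  + exact: measurable_funN.
  + by apply: filterS s1 => t; rewrite normrN.
  have ish := integrable01_mul_bounded ms s1 ih.
  rewrite -[RHS]oppr0 -sh0 -mulN1r -meanZ//.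
  by congr mean; apply/funext => t; rewrite mulNr mulN1r.
by move=> psi ipsi; exact: mulH1_of_mul_Re_inner.
Qed.

End ToeplitzKernel.

Section QuotientBall.
Variable R : realType.
Variables X Y : (R -> R[i]) -> Prop.
Hypotheses (linX : linear_subspace X) (linY : linear_subspace Y).
Hypotheses (XL1 : forall f, X f -> L1 f) (YX : forall f, Y f -> X f).
Implicit Types f g h p : R -> R[i].

Lemma qnorm_le_norm1 f h : Y (fun t => h t - f t) -> qnorm Y f <= norm1 h.
Proof.
move=> Yhf; apply: ge_inf; first by exists 0 => _ [y [_ ->]]; exact: norm1_ge0.
exists (fun t => h t - f t); split=> //; congr norm1; apply/funext => t.
by rewrite addrC subrK.
Qed.

Lemma Mset_sub f h : X f -> Mset Y f h -> X h.
Proof.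
move=> Xf [/YX Xhf _]; apply: eq_fun_pred (linear_subspaceD linX Xhf Xf) => t.
by rewrite subrK.
Qed.

Lemma Mset_half_sum f g1 g2 : X g1 -> X g2 ->
  norm1 g1 <= qnorm Y f -> norm1 g2 <= qnorm Y f ->
  Y (fun t => (g1 t + g2 t) / 2 - f t) -> Mset Y f (fun t => (g1 t + g2 t) / 2).
Proof.
move=> /XL1 L1g1 /XL1 L1g2 n1 n2 Ym; split=> //; apply/eqP; rewrite eq_le.
rewrite qnorm_le_norm1// andbT; apply: le_trans (norm1_half_sum_le L1g1 L1g2) _.
by lra.
Qed.

Lemma Mset_midpoint f g1 g2 : X f -> Mset Y f g1 -> Mset Y f g2 ->
  Mset Y f (fun t => (g1 t + g2 t) / 2).
Proof.
move=> Xf M1 M2; have [[Y1 n1] [Y2 n2]] := (M1, M2).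
apply: (Mset_half_sum (Mset_sub Xf M1) (Mset_sub Xf M2)); rewrite ?n1 ?n2//.
apply: eq_fun_pred (linear_subspaceZ 2^-1 linY (linear_subspaceD linY Y1 Y2)) => t.
by field.
Qed.

Lemma extreme_coset_perturbation f h p : extreme_coset X Y f -> X f -> Mset Y f h ->
  X p -> norm1 (fun t => h t + p t) <= 1 -> norm1 (fun t => h t - p t) <= 1 -> Y p.
Proof.
move=> [_ ext] Xf Mh Xp np nm; have Xh := Mset_sub Xf Mh; have [Yhf _] := Mh.
have [Y0 _] := linY; have qle g : norm1 g <= 1 -> qnorm Y g <= 1.
  by apply: le_trans; apply: qnorm_le_norm1; under eq_fun do rewrite subrr.
have Xhp := linear_subspaceD linX Xh Xp; have Xhm := linear_subspaceB linX Xh Xp.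
have := ext _ _ Xhp Xhm (qle _ np) (qle _ nm).
have Yfh : Y (fun t => f t - (h t + p t + (h t - p t)) / 2).
  by apply: eq_fun_pred (linear_subspaceZ (-1) linY Yhf) => t; field.
by move=> /(_ Yfh)/(linear_subspaceZ 2^-1 linY); apply: eq_fun_pred => t; field.
Qed.

Hypothesis Y_null : forall f, X f -> ae01 (fun t => f t = 0) -> Y f.

Lemma extreme_coset_of_half_sums f : proximinal X Y -> qnorm Y f = 1 ->
  (forall g1 g2, X g1 -> X g2 -> norm1 g1 <= 1 -> norm1 g2 <= 1 ->
     Mset Y f (fun t => (g1 t + g2 t) / 2) -> ae01 (fun t => g1 t = g2 t)) ->
  extreme_coset X Y f.
Proof.
move=> prox qf strict; split=> [|g1 g2 X1 X2 q1 q2 Yfg]; first by rewrite qf.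
have [m1 M1] := prox _ X1; have [m2 M2] := prox _ X2.
have Xm1 := Mset_sub X1 M1; have Xm2 := Mset_sub X2 M2.
have [Y1 n1] := M1; have [Y2 n2] := M2.
have Ym : Y (fun t => (m1 t + m2 t) / 2 - f t).
  apply: eq_fun_pred (linear_subspaceB linY
    (linear_subspaceZ 2^-1 linY (linear_subspaceD linY Y1 Y2)) Yfg) => t.
  by field.
have m12 : ae01 (fun t => m1 t = m2 t).
  have {}q1 : norm1 m1 <= 1 by rewrite n1.
  have {}q2 : norm1 m2 <= 1 by rewrite n2.
  by apply: (strict _ _ Xm1 Xm2 q1 q2); apply: (Mset_half_sum Xm1 Xm2 _ _ Ym); rewrite qf.
have Ym12 : Y (fun t => m1 t - m2 t).
  apply: Y_null; first exact: linear_subspaceB.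
  by apply: filterS m12 => t ->; rewrite subrr.
apply: eq_fun_pred (linear_subspaceD linY (linear_subspaceB linY Y2 Y1) Ym12) => t.
by ring.
Qed.

End QuotientBall.

Section ExtremeCosets.
Variables (R : realType) (phi psi f : R -> R[i]).
Hypotheses (ipsi : inner psi) (kf : K1 phi f) (qf : qnorm (Espace phi psi) f = 1).

Let linK : linear_subspace (K1 phi). Proof. exact: linear_subspace_K1. Qed.
Let linE : linear_subspace (Espace phi psi). Proof. exact: linear_subspace_Espace. Qed.
Let EK g : Espace phi psi g -> K1 phi g. Proof. by case. Qed.

Lemma K1_Mset h : Mset (Espace phi psi) f h -> K1 phi h.
Proof. exact: (Mset_sub linK EK kf). Qed.

Lemma extreme_coset_rel_prime h : extreme_coset (K1 phi) (Espace phi psi) f ->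
  Mset (Espace phi psi) f h -> rel_prime_inner h (toeplitz_dual phi h).
Proof.
move=> ext Mh [J [iJ [nJ [hhJ hdhJ]]]]; have kh := K1_Mset Mh.
have [Ehf nh] := Mh; rewrite qf in nh.
have [p [kp np nm pdiv]] := common_divisor_perturbation kh iJ nJ hhJ hdhJ.
have [_ /(pdiv _ ipsi) psih] : Espace phi psi p.
  by apply: (extreme_coset_perturbation linK linE EK ext kf Mh kp); rewrite ?np ?nm nh.
have Ef : Espace phi psi (fun t => 0 - f t).
  by apply: eq_fun_pred (linear_subspaceB linE Ehf (conj kh psih)) => t; ring.
by have := qnorm_le_norm1 Ef; rewrite qf norm1_cst cmod0 ler10.
Qed.

Lemma extreme_coset_Mset_unique h xi : extreme_coset (K1 phi) (Espace phi psi) f ->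
  Mset (Espace phi psi) f h -> Mset (Espace phi psi) f xi -> ae01 (fun t => xi t = h t).
Proof.
move=> ext Mh Mxi; have [[_ nh] [_ nxi]] := (Mh, Mxi).
have Mm := Mset_midpoint linK linE (@K1_L1 _ phi) EK kf Mxi Mh; have [_ nm] := Mm.
apply: (rel_prime_half_sum (K1_Mset Mxi) (K1_Mset Mh) (K1_Mset Mm)).
- exact: filterE.
- by rewrite nxi nm.
- by rewrite nh nm.
exact: extreme_coset_rel_prime Mm.
Qed.

Lemma rel_prime_extreme_coset h : proximinal (K1 phi) (Espace phi psi) ->
  Mset (Espace phi psi) f h ->
  (forall xi, Mset (Espace phi psi) f xi -> ae01 (fun t => xi t = h t)) ->
  rel_prime_inner h (toeplitz_dual phi h) ->
  extreme_coset (K1 phi) (Espace phi psi) f.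
Proof.
move=> prox Mh h_uniq rp; have [_ nh] := Mh; rewrite qf in nh.
apply: (extreme_coset_of_half_sums linK linE _ EK _ prox qf).
- exact: K1_L1.
- exact: Espace_null.
move=> g1 g2 k1 k2 n1 n2 Mm.
apply: (rel_prime_half_sum k1 k2 (K1_Mset Mh)); rewrite ?nh//.
by apply: filterS (h_uniq _ Mm) => t ->.
Qed.

End ExtremeCosets.

Theorem theorem1p2 (R : realType) (phi psi f : R -> R[i]) :
  Linf phi ->
  (exists g, K1 phi g /\ ~ ae01 (fun t => g t = 0)) ->
  inner psi -> nonconstant psi ->
  proximinal (K1 phi) (Espace phi psi) ->
  K1 phi f ->
  qnorm (Espace phi psi) f = 1 ->
  (extreme_coset (K1 phi) (Espace phi psi) f <->
   exists h, K1 phi h /\ Mset (Espace phi psi) f h /\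
     (forall xi, Mset (Espace phi psi) f xi -> ae01 (fun t => xi t = h t)) /\
     rel_prime_inner h (fun t => conjc (zid t * phi t * h t))).
Proof.
move=> _ _ ipsi _ prox kf qf; split=> [ext|[h [_ [Mh [h_uniq rp]]]]].
  have [h Mh] := prox f kf; exists h; split; first exact: K1_Mset Mh.
  split=> //; split=> [xi Mxi|].
    exact: extreme_coset_Mset_unique ext Mh Mxi.
  exact: extreme_coset_rel_prime ext Mh.
exact: rel_prime_extreme_coset prox Mh h_uniq rp.
Qed.
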